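(* Let $\Gamma$ be a nondegenerate compact graph having a positive curved trace. Then $T(\Gamma)=1$.
   Context: A nondegenerate graph is the graph in $\mathbb R^2$ of a continuous function over a compact interval of positive length. A compact rectifiable curve $\Gamma\subset\mathbb R^2$ has a positive curved trace if there are a compact $C^2$ graph $\Sigma=\{(x,g(x)):x\in I\}$ ($I$ a compact interval, $g\in C^2(I)$), a compact set $A\subset\Gamma\cap\Sigma$, and a constant $c_0>0$ such that $\mathcal H^1(A)>0$ and $|g''(x)|\ge c_0$ for every $x\in I$, where $\mathcal H^1$ is one-dimensional Hausdorff measure. For a compact curve $\Gamma$, \[ T(\Gamma)=\inf\{t:\ \dim_{\mathrm H}(E)>t\Longrightarrow|E+\Gamma|>0\ \text{ for every compact }E\subset\mathbb R^2\}, \] where $E+\Gamma=\{x+y:x\in E,\ y\in\Gamma\}$, $|\cdot|$ is planar Lebesgue measure, and $\dim_{\mathrm H}$ is Hausdorff dimension. *)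

(* Defs.v *)
From HB Require Import structures.
From mathcomp Require Import all_boot all_order all_algebra.
From mathcomp Require Import all_classical all_reals all_analysis.
Set Implicit Arguments.
Unset Strict Implicit.
Unset Printing Implicit Defensive.
Import Order.TTheory GRing.Theory Num.Theory.
Import numFieldNormedType.Exports.

Local Open Scope classical_set_scope.
Local Open Scope ring_scope.

(* The library norm on R * R is the sup norm, hence a separate Euclidean
   distance for diameters and lengths; the two induce the same topology. *)
Definition eucl_dist (R : realType) (p q : R * R) : R :=
  Num.sqrt ((p.1 - q.1) ^+ 2 + (p.2 - q.2) ^+ 2).

(* Adjoining 0 only affects the empty set, whose diameter is then 0. *)
Definition eucl_diam (R : realType) (U : set (R * R)) : \bar R :=
  ereal_sup (0%E |` [set e | exists p q, [/\ U p, U q & e = (eucl_dist p q)%:E]]).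

(* As 0 `^ 0 = 1, empty sets are treated apart: they contribute 0 even
   when s = 0, so that the measure of dimension 0 counts points. *)
Definition hausdorff_gauge (R : realType) (s : R) (U : set (R * R)) : \bar R :=
  if U == set0 then 0%E else poweR (eucl_diam U) s.

Definition hausdorff_premeasure (R : realType) (s delta : R)
    (A : set (R * R)) : \bar R :=
  ereal_inf [set e | exists U : (set (R * R))^nat,
    [/\ A `<=` \bigcup_k U k,
        forall k, (eucl_diam (U k) <= delta%:E)%E &
        e = (\sum_(0 <= k <oo) hausdorff_gauge s (U k))%E]].

(* No normalizing constant: for s = 1 it is equal to 1, and only the
   vanishing of the other measures is used. *)
Definition hausdorff_measure (R : realType) (s : R) (A : set (R * R)) :
    \bar R :=
  ereal_sup [set hausdorff_premeasure s delta A | delta in [set d | 0 < d]].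

Definition hausdorff_dim (R : realType) (A : set (R * R)) : \bar R :=
  ereal_inf [set s%:E | s in
    [set s : R | 0 <= s /\ hausdorff_measure s A = 0%E]].

(* The product measure is meaningful on Borel sets only; it is applied below
   to sums of compact sets, which are compact. *)
Definition planar_lebesgue (R : realType) (A : set (R * R)) : \bar R :=
  (@lebesgue_measure R \x @lebesgue_measure R)%E A.

Definition minkowski_sum (R : realType) (E G : set (R * R)) : set (R * R) :=
  [set x + y | x in E & y in G].

Definition graph_on (R : realType) (a b : R) (f : R -> R) : set (R * R) :=
  [set (x, f x) | x in `[a, b]].

Definition nondegenerate_graph (R : realType) (G : set (R * R)) : Prop :=
  exists (a b : R) (f : R -> R),
    [/\ a < b, {within `[a, b], continuous f} & G = graph_on a b f].

Definition polygonal_length (R : realType) (a b : R) (gamma : R -> R * R)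
    (s : seq R) : R :=
  let F := gamma \o nth b (a :: s) in
  \sum_(0 <= n < size s) eucl_dist (F n) (F n.+1).

Definition rectifiable_curve (R : realType) (G : set (R * R)) : Prop :=
  exists (a b : R) (gamma : R -> R * R),
    [/\ a <= b, {within `[a, b], continuous gamma},
        G = gamma @` `[a, b] &
        has_ubound [set polygonal_length a b gamma s | s in itv_partition a b]].

(* Derivative relative to D: one-sided at the endpoints of an interval. *)
Definition has_derivative_in (R : realType) (D : set R) (f : R -> R)
    (x l : R) : Prop :=
  (fun y => (f y - f x) / (y - x)) @ within D x^' --> l.

(* g is C^2 on [a, b], with first and second derivatives g1 and g2 there. *)
Definition C2_on (R : realType) (a b : R) (g g1 g2 : R -> R) : Prop :=
  [/\ forall x, x \in `[a, b] -> has_derivative_in `[a, b] g x (g1 x),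
      forall x, x \in `[a, b] -> has_derivative_in `[a, b] g1 x (g2 x) &
      {within `[a, b], continuous g2}].

(* If a = b then C2_on is vacuous, but so is the existence of A, since
   points have zero one-dimensional measure. *)
Definition positive_curved_trace (R : realType) (G : set (R * R)) : Prop :=
  exists (a b : R) (g g1 g2 : R -> R) (A : set (R * R)) (c0 : R),
    [/\ a <= b, C2_on a b g g1 g2,
        compact A /\ A `<=` G `&` graph_on a b g,
        (0 < hausdorff_measure 1 A)%E &
        0 < c0 /\ (forall x, x \in `[a, b] -> c0 <= `|g2 x|)].

Definition sum_threshold (R : realType) (G : set (R * R)) : \bar R :=
  ereal_inf [set t%:E | t in [set t : R |
    forall E : set (R * R), compact E ->
      (t%:E < hausdorff_dim E)%E ->
      (0 < planar_lebesgue (minkowski_sum E G))%E]].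

(* Main.v *)
Require Import Defs.
From HB Require Import structures.
From mathcomp Require Import all_boot all_order all_algebra.
From mathcomp Require Import all_classical all_reals all_analysis.
From mathcomp Require Import measurable_realfun zify ring lra.

(** The threshold of a graph is at least 1 for a reason that has nothing to do
with curvature, and at most 1 because translates of a curved arc meet
transversally enough.

Lower bound. Given t < 1, let C be the Cantor set of ratio
r = 2 ^ (- 1 / u) with t < u < 1, and let E = {0} x C. Every vertical section
of the sum of E with the graph of f is a translate of C, which is Lebesgue
null, so the sum is null ([vertical_cantor_sum_null]). On the other hand E has
dimension at least u ([vertical_cantor_dim]): the point of C with binary
address y expands distances, in the sense that it moves by at least
(1 - 2 r) |y - z| ^ (1 / u) when y moves to z ([cantor_point_expands]), so that
a cover of C by sets of diameters d_k yields a cover of [0, 1[ by intervals of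
length comparable to d_k ^ u.

Upper bound. Let dim E > 1, and let A be a compact part of the given curve
that lies on a C^2 graph of g with |g''| >= c0. The projection P of A to the
first axis has positive length, as a Lipschitz graph over a null set is null
([lipschitz_graph_null]). Fix a small scale d, put weights w_i on finitely many
points x_i of E, and compare the vertical d-neighbourhoods N_i of x_i + A:

- each N_i has area at least 2 d |P|;
- N_i and N_j intersect in area at most C d^2 / max(|x_i - x_j|, d), because
  where two translates of g come close, their difference has a derivative at
  least a multiple of |x_i - x_j|, unless this distance is itself of order d
  ([translates_overlap]); this bound holds for the full graph, so it survives
  the passage to the irregular subset A;
- by Cauchy-Schwarz ([overlap_cauchy_schwarz]) the area of the union of the
  N_i is at least a constant times (sum w_i)^2 divided by the energy
  sum_ij w_i w_j / max(|x_i - x_j|, d).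

Since E has positive s-dimensional measure for some s > 1, the weights can be
chosen with a fixed total and with mass at most a multiple of rho ^ s in each
square of side rho >= d: this is Frostman's lemma at a finite scale
([discrete_frostman]), which reduces to a max-flow min-cut argument on the
finite tree of dyadic squares ([frostman_cover]). Such weights have an energy
bounded independently of d, because s > 1 ([discrete_energy]). Hence the
d-neighbourhoods of E + A have areas bounded below, and so has their
intersection E + A ([planar_lebesgue_thickening], [curve_sum_positive]).
Working with finite sums at each scale avoids constructing a limit measure. *)

Set Implicit Arguments.
Unset Strict Implicit.
Unset Printing Implicit Defensive.
Import Order.TTheory GRing.Theory Num.Theory.
Import numFieldNormedType.Exports.

Local Open Scope classical_set_scope.
Local Open Scope ring_scope.

(** * Frostman weights on a finite tree of cells *)

Lemma nested_cells (I : Type) (T : Type) (cell : nat -> I -> T) :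
  (forall k i j, cell k.+1 i = cell k.+1 j -> cell k i = cell k j) ->
  forall k l i j, (k <= l)%N -> cell l i = cell l j -> cell k i = cell k j.
Proof.
move=> nest k l i j; elim: l => [|l IH]; first by rewrite leqn0 => /eqP ->.
rewrite leq_eqVlt => /orP[/eqP ->//|]; rewrite ltnS => kl /nest; exact: IH.
Qed.

(** The capacity of the finest cells is first shared out evenly inside each of
them; then coarser levels are treated one at a time, scaling down the weights
of every overfull cell to its capacity. Scaling down preserves the constraints
of the finer levels, and every point remains in some cell filled to capacity:
its former one if it has not been rescaled, the rescaled one otherwise. *)
Lemma frostman_weights (R : realFieldType) (I : finType) (T : eqType)
    (cell : nat -> I -> T) (cap : nat -> R) (n : nat) :
  (forall k, 0 < cap k) ->
  (forall k i j, cell k.+1 i = cell k.+1 j -> cell k i = cell k j) ->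
  exists w : I -> R, [/\ forall i, 0 <= w i,
    forall k c, (k <= n)%N -> \sum_(j | cell k j == c) w j <= cap k &
    forall i, exists2 k, (k <= n)%N &
      \sum_(j | cell k j == cell k i) w j = cap k].
Proof.
move=> cap0 nest.
suff H m : (m <= n)%N -> exists w : I -> R, [/\ forall i, 0 <= w i,
    forall k c, (n - m <= k <= n)%N -> \sum_(j | cell k j == c) w j <= cap k &
    forall i, exists2 k, (n - m <= k <= n)%N &
      \sum_(j | cell k j == cell k i) w j = cap k].
  have [w [w0 w1 w2]] := H n (leqnn n); exists w; split => //.
    by move=> k c kn; apply: w1; rewrite subnn.
  by move=> i; have [k] := w2 i; rewrite subnn => kn e; exists k.
elim: m => [_|m IH mn].
  pose N i := (\sum_(j | cell n j == cell n i) (1 : R)).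
  have N0 i : 0 < N i.
    rewrite /N (bigD1 i)//=; apply: ltr_pwDl => //; exact: sumr_ge0.
  have tot i : \sum_(j | cell n j == cell n i) cap n / N j = cap n.
    rewrite (eq_bigr (fun=> cap n / N i * 1)); last first.
      by move=> j /eqP e; rewrite /N e mulr1.
    by rewrite -mulr_sumr mulfVK// gt_eqF.
  exists (fun i => cap n / N i); split.
  - by move=> i; rewrite divr_ge0// ltW.
  - move=> k c; rewrite subn0 -eqn_leq => /eqP <-.
    have [/existsP[i /eqP <-]|] := boolP [exists i, cell n i == c].
      by rewrite tot.
    rewrite negb_exists => /forallP h; rewrite big_pred0; first exact: ltW.
    by move=> j; apply/negbTE.
  - by move=> i; exists n; rewrite ?tot// subn0 leqnn.
have [w [w0 w1 w2]] := IH (ltnW mn).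
set l := (n - m.+1)%N.
have ln : (l <= n)%N by rewrite leq_subr.
have lS : (n - m = l.+1)%N by rewrite /l subnSK.
pose M i := \sum_(j | cell l j == cell l i) w j.
have M0 i : 0 <= M i by apply: sumr_ge0.
pose sc i := if M i <= cap l then 1 else cap l / M i.
have sc0 i : 0 <= sc i by rewrite /sc; case: ifP => // _; rewrite divr_ge0// ltW.
have sc1 i : sc i <= 1.
  rewrite /sc; case: ifPn => //; rewrite -ltNge => h.
  by rewrite ler_pdivrMr ?mul1r ?ltW// (lt_trans (cap0 l)).
have scE i j : cell l i = cell l j -> sc i = sc j by rewrite /sc /M => ->.
exists (fun i => sc i * w i); split.
- by move=> i; rewrite mulr_ge0.
- move=> k c; rewrite leq_eqVlt => /andP[/orP[/eqP <- _|lk kn]].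
    have [/existsP[i /eqP <-]|] := boolP [exists i, cell l i == c]; last first.
      rewrite negb_exists => /forallP h; rewrite big_pred0; first exact: ltW.
      by move=> j; apply/negbTE.
    rewrite (eq_bigr (fun j => sc i * w j)); last by move=> j /eqP/scE ->.
    rewrite -mulr_sumr -/(M i) /sc; case: ifPn; first by rewrite mul1r.
    rewrite -ltNge => h; rewrite mulfVK// gt_eqF//; exact: lt_trans h.
  apply: le_trans (w1 k c _); last by rewrite lS lk.
  by apply: ler_sum => j _; rewrite ler_piMl.
- move=> i; have [Mi|Mi] := leP (M i) (cap l).
    have [k kn e] := w2 i; exists k.
      by case/andP: kn => h ->; rewrite andbT (leq_trans _ h)// lS.
    rewrite -e; apply: eq_bigr => j /eqP ej.
    have /scE -> : cell l j = cell l i.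
      by apply: (nested_cells nest _ ej); case/andP: kn; rewrite lS => /ltnW.
    by rewrite /sc Mi mul1r.
  exists l; first by rewrite leqnn.
  rewrite (eq_bigr (fun j => sc i * w j)); last by move=> j /eqP/scE ->.
  rewrite -mulr_sumr -/(M i) /sc leNgt Mi/= mulfVK// gt_eqF//; exact: lt_trans Mi.
Qed.

(** Max-flow min-cut on a tree. The coarsest full cells are pairwise disjoint
because cells are nested, and every point lies in one of them; so the total
weight is the sum of their capacities, that is, the cost of a cover. *)
Lemma frostman_cover (R : realFieldType) (I : finType) (T : eqType)
    (cell : nat -> I -> T) (cap : nat -> R) (n : nat) :
  (forall k, 0 < cap k) ->
  (forall k i j, cell k.+1 i = cell k.+1 j -> cell k i = cell k j) ->
  exists (w : I -> R) (D : seq (nat * T)), [/\ forall i, 0 <= w i,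
    forall k c, (k <= n)%N -> \sum_(j | cell k j == c) w j <= cap k,
    forall i, exists2 k, (k <= n)%N & (k, cell k i) \in D &
    \sum_(d <- D) cap d.1 = \sum_i w i].
Proof.
move=> cap0 nest; have [w [w0 w1 w2]] := frostman_weights n cap0 nest.
pose sat i k := (k <= n)%N && (\sum_(j | cell k j == cell k i) w j == cap k).
have satE i : exists k, sat i k.
  by have [k kn e] := w2 i; exists k; rewrite /sat kn e eqxx.
pose lev i := ex_minn (satE i).
have levP i : sat i (lev i) /\ forall k, sat i k -> (lev i <= k)%N.
  by rewrite /lev; case: ex_minnP.
pose phi i := (lev i, cell (lev i) i).
have lev_le i j : cell (lev i) j = cell (lev i) i -> (lev j <= lev i)%N.
  move=> e; apply: (levP j).2; have := (levP i).1; rewrite /sat => /andP[-> /=].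
  by rewrite e.
have phiE i j : (phi j == phi i) = (cell (lev i) j == cell (lev i) i).
  apply/eqP/eqP => [[-> //]|e].
  suff el : lev j = lev i by rewrite /phi el e.
  have le_ji := lev_le _ _ e; apply/eqP; rewrite eqn_leq le_ji/=.
  by apply: lev_le; exact: esym (nested_cells nest le_ji e).
exists w, (undup [seq phi i | i <- enum I]); split=> //.
  move=> i; exists (lev i); first by have [/andP[]] := levP i.
  by rewrite mem_undup; apply/mapP; exists i; rewrite ?mem_enum.
transitivity (\sum_(d <- undup [seq phi i | i <- enum I])
                \sum_(i | phi i == d) w i).
  rewrite big_seq [RHS]big_seq; apply: eq_bigr => d.
  rewrite mem_undup => /mapP[i _ ->].
  under eq_bigl do rewrite phiE.
  by have [/andP[_ /eqP ->]] := levP i.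
rewrite (exchange_big_dep xpredT)//=; apply: eq_bigr => i _.
rewrite (eq_bigl (fun d => d == phi i)) => [|d]; last by rewrite eq_sym.
rewrite -big_filter filter_pred1_uniq ?undup_uniq ?big_seq1//.
by rewrite mem_undup map_f// mem_enum.
Qed.

(** * An overlap form of the Cauchy-Schwarz inequality *)

Lemma measurable_sum_indic d (T : measurableType d) (R : realType)
    (I : finType) (N : I -> set T) (w : I -> R) :
  (forall i, measurable (N i)) ->
  measurable_fun setT (fun x => (\sum_i w i * \1_(N i) x)%:E).
Proof.
move=> mN; apply/measurable_EFinP; apply: measurable_sum => i.
by apply: measurable_funM.
Qed.

Lemma integral_sum_indic d (T : measurableType d) (R : realType)
    (mu : {measure set T -> \bar R}) (I : finType) (N : I -> set T)
    (w : I -> R) :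
  (forall i, measurable (N i)) -> (forall i, 0 <= w i) ->
  (\int[mu]_x (\sum_i w i * \1_(N i) x)%:E = \sum_i (w i)%:E * mu (N i))%E.
Proof.
move=> mN w0; under eq_integral do rewrite -sumEFin.
rewrite ge0_integral_sum//=.
- apply: eq_bigr => i _; under eq_integral do rewrite EFinM.
  rewrite ge0_integralZl_EFin//; first by rewrite integral_indic// setIT.
  + by apply/measurable_EFinP; exact: measurable_indic.
- by move=> i; apply/measurable_EFinP; apply: measurable_funM.
- by move=> i x _; rewrite lee_fin mulr_ge0// indicE.
Qed.

(** The Cauchy-Schwarz inequality for the function f that sums w_i over the sets
N_i containing a point, supported in S, written as the integral of
(f - t 1_S)^2 >= 0; the parameter t replaces a division by the measure of S,
which may be 0 or infinite. *)
Lemma overlap_cauchy_schwarz d (T : measurableType d) (R : realType)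
    (mu : {measure set T -> \bar R}) (I : finType) (N : I -> set T)
    (S : set T) (w : I -> R) (t : R) :
  (forall i, measurable (N i)) -> measurable S ->
  (forall i, N i `<=` S) -> (forall i, 0 <= w i) -> 0 <= t ->
  (\sum_i (2 * t * w i)%:E * mu (N i) <=
   \sum_(p : I * I) (w p.1 * w p.2)%:E * mu (N p.1 `&` N p.2)
     + (t ^+ 2)%:E * mu S)%E.
Proof.
move=> mN mS NS w0 t0.
have mNN (p : I * I) : measurable (N p.1 `&` N p.2) by exact: measurableI.
rewrite -(integral_sum_indic mu mN) => [|i]; last by rewrite !mulr_ge0.
rewrite -(integral_sum_indic mu mNN) => [|i]; last by rewrite !mulr_ge0.
have -> : ((t ^+ 2)%:E * mu S = \int[mu]_x (t ^+ 2 * \1_S x)%:E)%E.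
  under eq_integral do rewrite EFinM.
  rewrite ge0_integralZl_EFin ?sqr_ge0//; first by rewrite integral_indic// setIT.
  by apply/measurable_EFinP; exact: measurable_indic.
have mt : measurable_fun setT (fun x => (t ^+ 2 * \1_S x)%:E).
  by apply/measurable_EFinP; apply: measurable_funM.
rewrite -ge0_integralD//=; first last.
- by move=> x _; rewrite lee_fin mulr_ge0 ?sqr_ge0// indicE.
- exact: measurable_sum_indic mNN.
- by move=> x _; rewrite lee_fin sumr_ge0// => p _; rewrite !mulr_ge0// indicE.
apply: ge0_le_integral => //=.
- by move=> x _; rewrite lee_fin sumr_ge0// => p _; rewrite !mulr_ge0// indicE.
- exact: measurable_sum_indic.
- apply: emeasurable_funD => //; exact: measurable_sum_indic mNN.
move=> x _; rewrite -EFinD lee_fin.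
set a := \sum_i w i * \1_(N i) x.
have -> : \sum_i 2 * t * w i * \1_(N i) x = 2 * t * a.
  by rewrite /a mulr_sumr; apply: eq_bigr => i _; rewrite mulrA.
have -> : \sum_(p : I * I) w p.1 * w p.2 * \1_(N p.1 `&` N p.2) x = a ^+ 2.
  rewrite expr2 /a big_distrlr/= pair_big/=; apply: eq_bigr => p _.
  by rewrite indicI/= mulrACA.
have [xS|xS] := pselect (S x).
  by rewrite indicE mem_set// mulr1 -subr_ge0 (_ : _ - _ = (a - t) ^+ 2)
    ?sqr_ge0//; ring.
rewrite /a big1 ?expr2 ?mulr0 ?add0r ?mulr_ge0 ?indicE// => i _.
by rewrite indicE memNset ?mulr0// => /NS.
Qed.

(** * Intersections of translates of a curved graph *)

(** The form of differentiability used to add and translate relative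
derivatives, free of the quotient and of the filters. *)
Lemma has_derivative_eps (R : realType) (D : set R) (f : R -> R) (x l e : R) :
  has_derivative_in D f x l -> 0 < e ->
  exists2 d, 0 < d & forall y, D y -> y != x -> `|y - x| < d ->
    `|(f y - f x) - l * (y - x)| <= e * `|y - x|.
Proof.
move=> /cvgrPdist_le /(_ e) + e0 => /(_ e0).
rewrite near_withinE => -[d /= d0 H]; exists d => // y Dy yx yd.
have := H y _ yx Dy; rewrite /ball/= distrC => /(_ yd).
have nz : y - x != 0 by rewrite subr_eq0.
rewrite -(@ler_pM2r _ `|y - x|) ?normr_gt0// -normrM mulrBl divfK//.
by rewrite distrC.
Qed.

Lemma has_derivative_continuous (R : realType) (D : set R) (f df : R -> R) :
  (forall x, D x -> has_derivative_in D f x (df x)) ->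
  {within D, continuous f}.
Proof.
move=> df_; apply/subspace_continuousP => x Dx.
have [d d0 H] := has_derivative_eps (df_ x Dx) ltr01.
apply/cvgrPdist_le => /= e e0; rewrite near_withinE.
have K0 : 0 < 1 + `|df x| by rewrite ltr_pwDl.
near=> y => Dy.
have [->|yx] := eqVneq y x; first by rewrite subrr normr0 ltW.
have yd : `|y - x| < d by rewrite distrC; near: y; exact: cvgr_dist_lt.
have ye : `|y - x| <= e / (1 + `|df x|).
  by rewrite distrC; near: y; apply: cvgr_dist_le => //; rewrite divr_gt0.
rewrite distrC; apply: le_trans (_ : (1 + `|df x|) * `|y - x| <= _).
  rewrite mulrDl -normrM -{1}(subrK (df x * (y - x)) (f y - f x)).
  by apply: (le_trans (ler_normD _ _)); rewrite lerD2r; exact: H.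
by rewrite mulrC -ler_pdivlMr.
Unshelve. all: by end_near. Qed.

Lemma has_derivative_MVT (R : realType) (a b : R) (f df : R -> R) :
  (forall x, x \in `[a, b] -> has_derivative_in `[a, b] f x (df x)) ->
  forall x y, a <= x -> x < y -> y <= b ->
  exists2 z, z \in `]x, y[ & f y - f x = df z * (y - x).
Proof.
move=> df_ x y ax xy yb.
apply: MVT => //.
  move=> z zxy.
  have zab : z \in `[a, b].
    by move: zxy; rewrite !in_itv/= => /andP[? ?]; apply/andP; split; lra.
  have H : h^-1 *: ((f \o shift z) (h *: 1) - f z) @[h --> 0^'] --> df z.
    apply/cvgrPdist_le => /= e e0.
    have [d d0 H] := has_derivative_eps (df_ z zab) e0.
    near=> h.
    have h0 : h != 0 by near: h; exact: nbhs_dnbhs_neq.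
    have hd : `|h| < d by near: h; exact: dnbhs0_lt.
    have hx : `|h| < z - x.
      near: h; apply: dnbhs0_lt; move: zxy; rewrite in_itv/=; lra.
    have hy : `|h| < y - z.
      near: h; apply: dnbhs0_lt; move: zxy; rewrite in_itv/=; lra.
    have := H (h + z); rewrite addrK -subr_eq0 addrK => /(_ _ h0 hd) H1.
    rewrite distrC -(@ler_pM2r _ `|h|) ?normr_gt0// -normrM.
    rewrite [X in `|X|](_ : _ = f (h + z) - f z - df z * h); last first.
      by rewrite /= [h%:A]mulr1 /GRing.scale/=; field.
    apply: H1; rewrite /= in_itv/=.
    move: hx hy; rewrite !ltr_norml => /andP[? ?] /andP[? ?].
    apply/andP; split; lra.
  apply: DeriveDef; first by apply/cvg_ex; exists (df z).
  exact: cvg_lim.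
apply: (@continuous_subspaceW _ _ _ `[a, b]%classic).
  by move=> z /=; rewrite !in_itv/= => /andP[? ?]; apply/andP; split; lra.
exact: has_derivative_continuous df_.
Unshelve. all: by end_near. Qed.

Lemma has_derivative_epsI (R : realType) (D : set R) (f : R -> R) (x l : R) :
  (forall e, 0 < e -> exists2 d, 0 < d &
    forall y, D y -> y != x -> `|y - x| < d ->
    `|(f y - f x) - l * (y - x)| <= e * `|y - x|) ->
  has_derivative_in D f x l.
Proof.
move=> H; apply/cvgrPdist_le => /= e e0; have [d d0 Hd] := H e e0.
rewrite near_withinE; exists d => //= y; rewrite /ball/= distrC => yd yx Dy.
have nz : y - x != 0 by rewrite subr_eq0.
rewrite -(@ler_pM2r _ `|y - x|) ?normr_gt0// -normrM mulrBl divfK//.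
by rewrite distrC; exact: Hd.
Qed.

(** Two applications of the mean value theorem: to t |-> g (t + h) - g t, then to
g', which express the second difference as g'' at some point times
h (t' - t), whatever the sign of g''. *)
Lemma second_difference (R : realType) (a b c0 : R) (g g1 g2 : R -> R) :
  C2_on a b g g1 g2 -> 0 < c0 ->
  (forall x, x \in `[a, b] -> c0 <= `|g2 x|) ->
  forall t t' h, t \in `[a, b] -> t' \in `[a, b] ->
    t + h \in `[a, b] -> t' + h \in `[a, b] ->
    c0 * `|h| * `|t' - t| <= `|(g (t' + h) - g t') - (g (t + h) - g t)|.
Proof.
move=> [dg dg1 _] c00 g2c.
suff H t t' h : 0 < h -> t < t' -> a <= t -> t' + h <= b ->
    c0 * h * (t' - t) <= `|(g (t' + h) - g t') - (g (t + h) - g t)|.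
  have {}H t t' h : 0 < h -> t \in `[a, b] -> t' \in `[a, b] ->
      t + h \in `[a, b] -> t' + h \in `[a, b] ->
      c0 * h * `|t' - t| <= `|(g (t' + h) - g t') - (g (t + h) - g t)|.
    rewrite !in_itv/= => h0 /andP[? ?] /andP[? ?] /andP[? ?] /andP[? ?].
    have [tt'|t't|->] := ltgtP t t'; last by rewrite !subrr normr0 mulr0.
    - by rewrite gtr0_norm ?subr_gt0//; exact: H.
    - by rewrite distrC gtr0_norm ?subr_gt0// distrC; exact: H.
  move=> t t' h tI t'I thI t'hI.
  have [h0|h0|<-] := ltgtP 0 h; last by rewrite normr0 mulr0 mul0r.
    by rewrite (gtr0_norm h0); exact: H.
  have := H (t + h) (t' + h) (- h); rewrite !addrK oppr_gt0 (ltr0_norm h0).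
  move=> /(_ h0 thI t'hI tI t'I).
  rewrite (_ : t' + h - (t + h) = t' - t); last by ring.
  rewrite (_ : g t' - g (t' + h) - _ =
    - (g (t' + h) - g t' - (g (t + h) - g t))); last by ring.
  by rewrite normrN.
move=> h0 tt' at_ t'hb.
pose G z := g (z + h) - g z.
have dG z : z \in `[t, t'] -> has_derivative_in `[t, t'] G z (g1 (z + h) - g1 z).
  move=> zI; apply: has_derivative_epsI => e e0.
  move: (zI); rewrite in_itv/= => /andP[tz zt'].
  have zab : z \in `[a, b] by rewrite in_itv/=; apply/andP; split; lra.
  have zhab : z + h \in `[a, b] by rewrite in_itv/=; apply/andP; split; lra.
  have e20 : 0 < e / 2 by lra.
  have [d1 d10 H1] := has_derivative_eps (dg _ zab) e20.
  have [d2 d20 H2] := has_derivative_eps (dg _ zhab) e20.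
  exists (Num.min d1 d2); first by rewrite lt_min d10.
  move=> y; rewrite /= in_itv/= => /andP[ty yt'] yz; rewrite lt_min => /andP[y1 y2].
  have K1 : `|(g y - g z) - g1 z * (y - z)| <= e / 2 * `|y - z|.
    by apply: H1 => //; rewrite /= in_itv/=; apply/andP; split; lra.
  have E : y + h - (z + h) = y - z by ring.
  have K2 : `|(g (y + h) - g (z + h)) - g1 (z + h) * (y - z)| <= e / 2 * `|y - z|.
    have := H2 (y + h); rewrite E; apply => //.
      by rewrite /= in_itv/=; apply/andP; split; lra.
    by rewrite (inj_eq (addIr h)).
  have -> : G y - G z - (g1 (z + h) - g1 z) * (y - z) =
     ((g (y + h) - g (z + h)) - g1 (z + h) * (y - z)) -
     ((g y - g z) - g1 z * (y - z)) by rewrite /G; ring.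
  by apply: (le_trans (ler_normB _ _)); lra.
have [z zI ->] := has_derivative_MVT dG (lexx t) tt' (lexx t').
move: zI; rewrite in_itv/= => /andP[tz zt'].
have az : a <= z by lra.
have zzh : z < z + h by lra.
have zhb : z + h <= b by lra.
have [y yI ->] := has_derivative_MVT dg1 az zzh zhb.
rewrite addrAC subrr add0r !normrM (gtr0_norm h0) (@gtr0_norm _ (t' - t)) ?subr_gt0//.
rewrite ler_pM2r ?subr_gt0// ler_pM2r//; apply: g2c.
by move: yI; rewrite !in_itv/= => /andP[? ?]; apply/andP; split; lra.
Qed.

Lemma C2_lipschitz (R : realType) (a b : R) (g g1 g2 : R -> R) :
  C2_on a b g g1 g2 -> exists2 L, 0 <= L &
  forall x y, x \in `[a, b] -> y \in `[a, b] -> `|g x - g y| <= L * `|x - y|.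
Proof.
move=> [dg dg1 _].
have : compact (g1 @` `[a, b]%classic).
  apply: continuous_compact; last exact: segment_compact.
  exact: has_derivative_continuous dg1.
move=> /compact_bounded[M [_ MH]]; exists (`|M| + 1); first by rewrite addr_ge0.
have H x y : x \in `[a, b] -> y \in `[a, b] -> x < y ->
    `|g y - g x| <= (`|M| + 1) * (y - x).
  rewrite !in_itv/= => /andP[ax xb] /andP[ay yb] xy.
  have [z zI ->] := has_derivative_MVT dg ax xy yb.
  rewrite normrM (@gtr0_norm _ (y - x)) ?subr_gt0// ler_pM2r ?subr_gt0//.
  have := MH (`|M| + 1); apply; first by rewrite (le_lt_trans (ler_norm M))// ltrDl.
  exists z => //; move: zI; rewrite /= !in_itv/= => /andP[? ?].
  by apply/andP; split; lra.
move=> x y xI yI; have [xy|yx|->] := ltgtP x y; last by rewrite !subrr normr0 mulr0.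
- by rewrite distrC (distrC x) (@gtr0_norm _ (y - x)) ?subr_gt0//; exact: H.
- by rewrite (@gtr0_norm _ (x - y)) ?subr_gt0//; exact: H.
Qed.

(** Two cases are merged in this estimate. If x and y are further apart
horizontally, the gap between the translates varies at speed at least
c0 |x.1 - y.1|, so it stays below 2 d only briefly. If they are further apart
vertically, the Lipschitz bound forces |x.2 - y.2| <= L |x.1 - y.1| + 2 d as soon
as the translates come close, which leads back to the first case. *)
Lemma translates_overlap (R : realType) (a b c0 L : R) (g g1 g2 : R -> R) :
  C2_on a b g g1 g2 -> 0 < c0 ->
  (forall x, x \in `[a, b] -> c0 <= `|g2 x|) -> 0 <= L ->
  (forall x y, x \in `[a, b] -> y \in `[a, b] -> `|g x - g y| <= L * `|x - y|) ->
  forall (x y : R * R) (d u u' : R),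
    u - x.1 \in `[a, b] -> u - y.1 \in `[a, b] ->
    u' - x.1 \in `[a, b] -> u' - y.1 \in `[a, b] ->
    `|(x.2 + g (u - x.1)) - (y.2 + g (u - y.1))| <= 2 * d ->
    `|(x.2 + g (u' - x.1)) - (y.2 + g (u' - y.1))| <= 2 * d ->
    `|u - u'| * Num.max `|x - y| d <= (4 * (1 + L) / c0 + 3 * (b - a)) * d.
Proof.
move=> gC c00 g2c L0 gL x y d u u' ux uy u'x u'y H H'.
set X := `|x.1 - y.1|.
have X0 : 0 <= X by exact: normr_ge0.
have d0 : 0 <= d by have := le_trans (normr_ge0 _) H; lra.
have K : X * `|u - u'| <= 4 / c0 * d.
  have := second_difference gC c00 g2c (t := u' - x.1) (t' := u - x.1) (h := x.1 - y.1).
  rewrite !addrA !subrK -/X => /(_ u'x ux u'y uy).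
  rewrite (_ : u - x.1 - (u' - x.1) = u - u'); last by ring.
  move=> K; rewrite -(ler_pM2l c00) !mulrA.
  rewrite [X in _ <= X](_ : _ = 4 * d); last by field; rewrite gt_eqF.
  apply: le_trans K _.
  rewrite [X in `|X|](_ : _ =
    (x.2 + g (u' - x.1) - (y.2 + g (u' - y.1))) -
    (x.2 + g (u - x.1) - (y.2 + g (u - y.1)))); last by ring.
  by apply: (le_trans (ler_normB _ _)); lra.
have Y : `|x.2 - y.2| <= L * X + 2 * d.
  move: H; have := gL _ _ ux uy.
  rewrite (_ : u - x.1 - (u - y.1) = - (x.1 - y.1)); last by ring.
  rewrite normrN -/X !ler_norml => /andP[? ?] /andP[? ?].
  by apply/andP; split; lra.
have U : `|u - u'| <= b - a.
  rewrite (_ : u - u' = (u - x.1) - (u' - x.1)); last by ring.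
  move: ux u'x; rewrite !in_itv/= ler_norml => /andP[? ?] /andP[? ?].
  by apply/andP; split; lra.
(* Once the translates are close at one abscissa, the horizontal distance
   controls the whole distance up to a multiple of d. *)
have M : Num.max `|x - y| d <= (1 + L) * X + 3 * d.
  rewrite prod_normE/= -/X !ge_max.
  have ? : 0 <= L * X by rewrite mulr_ge0.
  by apply/andP; split; [apply/andP; split|]; lra.
apply: le_trans (_ : `|u - u'| * ((1 + L) * X + 3 * d) <= _).
  by rewrite ler_wpM2l.
have K1 : (1 + L) * (X * `|u - u'|) <= (1 + L) * (4 / c0 * d).
  by rewrite ler_wpM2l// addr_ge0.
have K2 : d * `|u - u'| <= d * (b - a) by rewrite ler_wpM2l.
rewrite (_ : 4 * (1 + L) / c0 = (1 + L) * (4 / c0)); last by field; rewrite gt_eqF.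
lra.
Qed.

(** * Compact plane sets and their vertical sections *)

Lemma finite_net (R : realType) (K : set (R * R)) (r : R) :
  compact K -> 0 < r -> exists s : seq (R * R),
    (forall x, x \in s -> K x) /\
    (forall y, K y -> exists2 x, x \in s & `|x - y| < r).
Proof.
move=> /compact_near_coveringP cK r0.
(* The net is extracted along the filter of large finite subsets of K. *)
pose F (A : set (seq (R * R))) := exists s0 : seq (R * R),
  (forall x, x \in s0 -> K x) /\ forall s, {subset s0 <= s} -> A s.
have FF : Filter F.
  split.
  - by exists [::].
  - move=> P Q [s [sK sP]] [t [tK tQ]]; exists (s ++ t); split.
      by move=> x; rewrite mem_cat => /orP[/sK|/tK].
    move=> v sv; split; [apply: sP|apply: tQ] => x xs; apply: sv;
      by rewrite mem_cat xs ?orbT.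
  - by move=> P Q PQ [s [sK sP]]; exists s; split=> // t /sP/PQ.
have [] := cK _ F (fun s y => exists2 x, x \in s & `|x - y| < r) FF.
  move=> x Kx; exists (ball x r, [set s : seq (R * R) | x \in s]).
    split; first exact: nbhsx_ballx.
    exists [:: x]; split=> [y|s]; first by rewrite inE => /eqP ->.
    by apply; rewrite mem_head.
  by move=> [y s] /= [xy xs]; exists x => //; move: xy; rewrite -ball_normE.
by move=> s [sK sP]; exists s; split=> // y; exact: sP.
Qed.

Lemma in_box (R : realType) (x y : R * R) (r : R) :
  (`[x.1 - r, x.1 + r] `*` `[x.2 - r, x.2 + r]) y <-> `|x - y| <= r.
Proof.
rewrite prod_normE/= ge_max !ler_norml/= !in_itv/=; split.
  by move=> -[/andP[? ?] /andP[? ?]]; apply/andP; split; apply/andP; split; lra.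
move=> /andP[/andP[? ?] /andP[? ?]]; split; apply/andP; split; lra.
Qed.

(** The sigma-algebra of the plane is generated by rectangles, and a compact
set is the intersection over n of the finite unions of squares given by its
1 / n-nets. *)
Lemma compact_plane_measurable (R : realType) (K : set (R * R)) :
  compact K -> measurable (K : set (measurableTypeR R * measurableTypeR R)).
Proof.
move=> cK; have clK : closed K.
  by apply: compact_closed => //; exact: norm_hausdorff.
have r0 n : 0 < n.+1%:R^-1 :> R by rewrite invr_gt0.
pose s n := sval (cid (finite_net cK (r0 n))).
have sP n := svalP (cid (finite_net cK (r0 n))).
pose box (x : R * R) (r : R) := `[x.1 - r, x.1 + r] `*` `[x.2 - r, x.2 + r].
have -> : K = \bigcap_n \bigcup_(x in [set` s n]) box x n.+1%:R^-1.
  apply/seteqP; split=> y.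
    move=> Ky n _; have [_ /(_ y Ky)[x xs xy]] := sP n.
    by exists x => //; apply/in_box/ltW.
  move=> H; apply: clK => B /nbhs_ballP[e /= e0 eB].
  have [n ne] : exists n, n.+1%:R^-1 < e.
    have /cvgrPdist_lt/(_ e e0) := @cvg_harmonic R.
    move=> [n _ /(_ n (leqnn n))]; rewrite sub0r normrN /harmonic => h.
    by exists n; rewrite (le_lt_trans (ler_norm _) h).
  have [x xs /in_box xy] := H n I; exists x; split; first exact: (sP n).1.
  by apply: eB; rewrite -ball_normE /= distrC (le_lt_trans xy).
apply: bigcap_measurable => // n _; apply: fin_bigcup_measurable.
  exact: finite_seq.
move=> x _; apply: measurableX; exact: measurable_itv.
Qed.

Lemma lebesgue_measure_centered (R : realType) (c r : R) : 0 <= r ->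
  @lebesgue_measure R `[c - r, c + r] = (2 * r)%:E.
Proof.
move=> r0; rewrite lebesgue_measure_itv/= lte_fin; case: ifPn => [_|].
  by rewrite -EFinB; congr _%:E; lra.
by rewrite -leNgt => ?; congr _%:E; lra.
Qed.

Lemma planar_section_lower (R : realType) (N : set (R * R)) (Q : set R) (d : R)
    (h : R -> R) :
  compact N -> measurable (Q : set (measurableTypeR R)) -> 0 <= d ->
  (forall u, Q u -> forall v, `|v - h u| <= d -> N (u, v)) ->
  ((2 * d)%:E * lebesgue_measure Q <= planar_lebesgue N)%E.
Proof.
move=> cN mQ d0 H; have mN := compact_plane_measurable cN.
rewrite /planar_lebesgue /product_measure1.
have -> : (lebesgue_measure Q = \int[@lebesgue_measure R]_u (\1_Q u)%:E)%E.
  by rewrite integral_indic// setIT.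
rewrite -ge0_integralZl_EFin//; first last.
- by rewrite mulr_ge0.
- by apply/measurable_EFinP; exact: measurable_indic.
apply: ge0_le_integral => //.
- by move=> x _; rewrite -EFinM lee_fin !mulr_ge0// indicE.
- by apply: measurable_funeM; apply/measurable_EFinP; exact: measurable_indic.
- exact: measurable_fun_xsection.
move=> u _ /=; have [Qu|Qu] := pselect (Q u); last first.
  by rewrite indicE memNset// mule0.
rewrite indicE mem_set// mule1.
rewrite -(lebesgue_measure_centered (h u))//; apply: le_measure; rewrite ?inE.
- exact: measurable_itv.
- exact: measurable_xsection.
move=> v /=; rewrite in_itv/= => /andP[? ?]; apply/mem_set/H => //.
by rewrite ler_norml; apply/andP; split; lra.
Qed.

Lemma planar_section_upper (R : realType) (N : set (R * R)) (d D : R)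
    (h : R -> R) :
  compact N -> 0 <= d -> 0 <= D ->
  (forall u v, N (u, v) -> `|v - h u| <= d) ->
  (forall u v u' v', N (u, v) -> N (u', v') -> `|u - u'| <= D) ->
  (planar_lebesgue N <= (2 * d * (2 * D))%:E)%E.
Proof.
move=> cN d0 D0 H HD; have mN := compact_plane_measurable cN.
have [->|/set0P[[u0 v0] N0]] := eqVneq N set0.
  by rewrite /planar_lebesgue measure0 lee_fin !mulr_ge0.
pose J := `[u0 - D, u0 + D]%classic : set (measurableTypeR R).
have mJ : measurable J by exact: measurable_itv.
rewrite EFinM -[X in (_ * X)%E](lebesgue_measure_centered u0)// -/J.
rewrite /planar_lebesgue /product_measure1.
have -> : (lebesgue_measure J = \int[@lebesgue_measure R]_u (\1_J u)%:E)%E.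
  by rewrite integral_indic// setIT.
rewrite -ge0_integralZl_EFin//; first last.
- by rewrite mulr_ge0.
- by apply/measurable_EFinP; exact: measurable_indic.
apply: ge0_le_integral => //.
- exact: measurable_fun_xsection.
- by apply: measurable_funeM; apply/measurable_EFinP; exact: measurable_indic.
move=> u _ /=; have [[v Nv]|Nu] := pselect (exists v, N (u, v)); last first.
  rewrite (_ : xsection N u = set0) ?measure0.
    by rewrite -EFinM lee_fin !mulr_ge0// indicE.
  by apply/seteqP; split=> // v; rewrite /xsection/= inE => Nv; apply: Nu; exists v.
rewrite indicE mem_set; last first.
  rewrite /J/= in_itv/=; have := HD _ _ _ _ Nv N0.
  by rewrite ler_norml => /andP[? ?]; apply/andP; split; lra.
rewrite mule1 -(lebesgue_measure_centered (h u))//; apply: le_measure; rewrite ?inE.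
- exact: measurable_xsection.
- exact: measurable_itv.
move=> w; rewrite /xsection/= inE => /H; rewrite in_itv/= ler_norml.
by move=> /andP[? ?]; apply/andP; split; lra.
Qed.

(** Uniqueness of Lebesgue measure applied to its image by a translation. *)
Lemma lebesgue_translate (R : realType) (P : set R) (c : R) :
  measurable (P : set (measurableTypeR R)) ->
  lebesgue_measure [set u | P (u - c)] = lebesgue_measure P.
Proof.
move=> mP.
have mf : measurable_fun setT
    ((fun u => u - c) : measurableTypeR R -> measurableTypeR R).
  by apply: measurable_funB => //; exact: measurable_cst.
pose nu : {measure set (measurableTypeR R) -> \bar R} :=
  pushforward (@lebesgue_measure R)
    ((fun u => u - c) : measurableTypeR R -> measurableTypeR R).
apply/esym; apply: (@lebesgue_measure_unique _ (nu mf)) => // _ [[x y] _ <-].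
have E : [set u | `]x, y]%classic (u - c)] = `]x + c, y + c]%classic.
  apply/seteqP; split=> u /=; rewrite !in_itv/= => /andP[? ?];
  by apply/andP; split; lra.
rewrite /= /nu /pushforward/= /preimage/= E !lebesgue_measure_itv/=.
rewrite !lte_fin ltrD2r; case: ifP => // _.
by rewrite -!EFinD; congr _%:E; ring.
Qed.

Lemma compact_minkowski (R : realType) (A B : set (R * R)) :
  compact A -> compact B -> compact (minkowski_sum A B).
Proof.
move=> cA cB.
have -> : minkowski_sum A B = (fun z : (R * R) * (R * R) => z.1 + z.2) @` (A `*` B).
  apply/seteqP; split=> [_ [x Ax [y By <-]]|_ [[x y] /= [Ax By] <-]].
    by exists (x, y).
  by exists x => //; exists y.
apply: continuous_compact; last exact: compact_setX.
apply: continuous_subspaceT => z; exact: add_continuous.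
Qed.

Lemma planar_lebesgue_lty (R : realType) (K : set (R * R)) :
  compact K -> (planar_lebesgue K < +oo)%E.
Proof.
move=> cK; have mK := compact_plane_measurable cK.
have [M [_ MH]] := compact_bounded cK.
pose r := `|M| + 1; have r0 : 0 <= r by rewrite addr_ge0.
have KM x : K x -> `|x| <= r.
  by apply: MH; rewrite (le_lt_trans (ler_norm M))// ltrDl.
pose J := `[0 - r, 0 + r]%classic : set (measurableTypeR R).
have mJ : measurable J by exact: measurable_itv.
apply: (@le_lt_trans _ _ (planar_lebesgue (J `*` J))).
  apply: le_measure; rewrite ?inE//; first exact: measurableX.
  move=> x /KM; rewrite prod_normE ge_max !ler_norml => /andP[? ?].
  by split; rewrite /J /= in_itv/= sub0r add0r.
rewrite /planar_lebesgue product_measure1E//.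
change (@lebesgue_measure R J * @lebesgue_measure R J < +oo)%E.
by rewrite [X in (X * X)%E]lebesgue_measure_centered// -EFinM ltry.
Qed.

Lemma compact_vertical (R : realType) (C : set R) :
  compact C -> compact [set ((0 : R), t) | t in C].
Proof.
move=> cC; apply: continuous_compact => //; apply: continuous_subspaceT => t.
exact: (@cvg_pair _ _ _ (nbhs t) (nbhs (0 : R)) (nbhs t) _ _ _ (fun=> 0) id
  (cvg_cst _) cvg_id).
Qed.

Definition vertical_segment (R : realType) (d : R) : set (R * R) :=
  [set (0, t) | t in `[- d, d]].

Lemma compact_vertical_segment (R : realType) (d : R) :
  compact (vertical_segment d).
Proof.
apply: compact_vertical; exact: segment_compact.
Qed.

(** A compact set is the decreasing intersection of its vertical
neighbourhoods, so its area is the limit of theirs. *)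
Lemma planar_lebesgue_thickening (R : realType) (S : set (R * R)) (c h : R) :
  compact S -> 0 < h ->
  (forall n, c%:E <= planar_lebesgue
     (minkowski_sum S (vertical_segment (h * 2^-1 ^+ n))))%E ->
  (c%:E <= planar_lebesgue S)%E.
Proof.
move=> cS h0 H.
pose F n := minkowski_sum S (vertical_segment (h * 2^-1 ^+ n)).
have cF n : compact (F n).
  by apply: compact_minkowski => //; exact: compact_vertical_segment.
have h20 : 0 < 2^-1 :> R by rewrite invr_gt0.
have h21 : 2^-1 < 1 :> R by rewrite invf_lt1// ltr1n.
have SE : S = \bigcap_n F n.
  apply/seteqP; split=> z.
    move=> Sz n _; exists z => //; exists 0; last by rewrite addr0.
    exists 0 => //; rewrite /= in_itv/= oppr_le0 andbb.
    by rewrite mulr_ge0 ?exprn_ge0// ltW.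
  move=> Fz; have : closed S.
    by apply: compact_closed => //; exact: norm_hausdorff.
  apply => B /nbhs_ballP[e /= e0 eB].
  have nh1 : `|2^-1| < 1 :> R by rewrite gtr0_norm.
  have d60 : 0 < e / h by rewrite divr_gt0.
  have /cvgrPdist_lt/(_ _ d60)[] := cvg_expr nh1.
  move=> n _ /(_ n (leqnn n)); rewrite sub0r normrN => hn.
  have [x Sx [_ [t tI <-] xz]] := Fz n I; exists x; split=> //; apply: eB.
  rewrite -ball_normE /= -xz addrAC subrr add0r prod_normE/= normr0.
  rewrite max_r//; apply: (@le_lt_trans _ _ (h * 2^-1 ^+ n)).
    by move: tI; rewrite /= in_itv/= ler_norml.
  rewrite mulrC -ltr_pdivlMr//; apply: le_lt_trans hn; exact: ler_norm.
have mF n : measurable (F n : set (measurableTypeR R * measurableTypeR R)).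
  exact: compact_plane_measurable.
have mS : measurable (\bigcap_n F n : set (measurableTypeR R * measurableTypeR R)).
  by rewrite -SE; exact: compact_plane_measurable.
have Fdec : {homo F : n m / (n <= m)%N >-> (m <= n)%O}.
  move=> n m nm; rewrite subsetEset => _ [x Sx [_ [t tI <-] <-]].
  exists x => //; exists (0, t) => //; exists t => //.
  have le : h * 2^-1 ^+ m <= h * 2^-1 ^+ n.
    by rewrite ler_pM2l// ler_wiXn2l// ltW.
  by move: tI; rewrite /= !in_itv/= => /andP[? ?]; apply/andP; split; lra.
have := @nonincreasing_cvg_mu _ _ _ (lebesgue_measure \x lebesgue_measure)%E F
  (planar_lebesgue_lty (cF 0%N)) mF mS Fdec.
rewrite -SE => cv; rewrite /planar_lebesgue.
rewrite -(cvg_lim _ cv)//; apply: lime_ge; first by apply/cvg_ex; eexists; exact: cv.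
by apply: nearW => n; exact: H.
Qed.

(** * Hausdorff gauges and Lipschitz graphs *)

Lemma eucl_dist_le (R : realType) (p q : R * R) :
  eucl_dist p q <= `|p.1 - q.1| + `|p.2 - q.2|.
Proof.
rewrite /eucl_dist -[X in _ <= X]ger0_norm ?addr_ge0// -[X in _ <= X]sqrtr_sqr.
apply: ler_wsqrtr; rewrite [X in _ <= X]sqrrD !real_normK ?num_real// addrAC lerDl.
by rewrite mulrn_wge0// mulr_ge0.
Qed.

Lemma eucl_dist_ge (R : realType) (p q : R * R) : `|p - q| <= eucl_dist p q.
Proof.
rewrite prod_normE ge_max /eucl_dist/= -!sqrtr_sqr; apply/andP; split;
  by apply: ler_wsqrtr; rewrite ?lerDl ?lerDr sqr_ge0.
Qed.

Lemma eucl_diam_ge0 (R : realType) (U : set (R * R)) : (0 <= eucl_diam U)%E.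
Proof. by apply: ereal_sup_ubound; left. Qed.

Lemma eucl_diam_le (R : realType) (U : set (R * R)) (r : R) :
  0 <= r -> (forall p q, U p -> U q -> eucl_dist p q <= r) ->
  (eucl_diam U <= r%:E)%E.
Proof.
move=> r0 H; apply: ge_ereal_sup => _ [->|[p [q [Up Uq ->]]]].
  by rewrite lee_fin.
by rewrite lee_fin; exact: H.
Qed.

Lemma eucl_diam_ub (R : realType) (U : set (R * R)) (p q : R * R) :
  U p -> U q -> ((eucl_dist p q)%:E <= eucl_diam U)%E.
Proof. by move=> Up Uq; apply: ereal_sup_ubound; right; exists p, q. Qed.

Lemma hausdorff_gauge_ge0 (R : realType) (s : R) (U : set (R * R)) :
  (0 <= hausdorff_gauge s U)%E.
Proof. by rewrite /hausdorff_gauge; case: ifP => // _; exact: poweR_ge0. Qed.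

Lemma hausdorff_gauge_le (R : realType) (s r : R) (U : set (R * R)) :
  0 <= s -> 0 <= r -> (eucl_diam U <= r%:E)%E ->
  (hausdorff_gauge s U <= (r `^ s)%:E)%E.
Proof.
move=> s0 r0 Ur; rewrite /hausdorff_gauge; case: ifP => _.
  by rewrite lee_fin powR_ge0.
rewrite -poweR_EFin; apply: gt0_ler_poweR => //; rewrite in_itv/= ?andbT.
- by rewrite eucl_diam_ge0 (le_trans Ur)// leey.
- by rewrite lee_fin r0 leey.
Qed.

Lemma hausdorff_premeasure_ge0 (R : realType) (s d : R) (A : set (R * R)) :
  (0 <= hausdorff_premeasure s d A)%E.
Proof.
apply: le_ereal_inf_tmp => _ [U [_ _ ->]]; apply: nneseries_ge0 => k _ _.
exact: hausdorff_gauge_ge0.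
Qed.

Lemma hausdorff_measure_eq0 (R : realType) (s : R) (A : set (R * R)) :
  (forall d e : R, 0 < d -> 0 < e -> (hausdorff_premeasure s d A <= e%:E)%E) ->
  hausdorff_measure s A = 0%E.
Proof.
move=> H; apply/eqP; rewrite eq_le; apply/andP; split; last first.
  apply: le_trans (hausdorff_premeasure_ge0 s 1 A) _.
  by apply: ereal_sup_ubound; exists 1 => //=.
apply: ge_ereal_sup => _ [d /= d0 <-]; apply/lee_addgt0Pr => e e0.
by rewrite add0e; exact: H.
Qed.

Lemma hausdorff_premeasure_le (R : realType) (s d : R) (A : set (R * R))
    (U : (set (R * R))^nat) :
  A `<=` \bigcup_k U k -> (forall k, (eucl_diam (U k) <= d%:E)%E) ->
  (hausdorff_premeasure s d A <= \sum_(0 <= k <oo) hausdorff_gauge s (U k))%E.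
Proof. by move=> AU Ud; apply: ereal_inf_lbound; exists U. Qed.

(** A cover of P by open intervals lifts to a cover of the graph by sets whose
diameters are at most 1 + L times the lengths of the intervals. Intervals of
small total length are individually short, so the bound on the diameters in
the Hausdorff premeasure is automatic. *)
Lemma lipschitz_graph_null (R : realType) (P : set R) (g : R -> R) (L : R) :
  measurable (P : set (measurableTypeR R)) -> lebesgue_measure P = 0%E ->
  0 <= L -> (forall x y, P x -> P y -> `|g x - g y| <= L * `|x - y|) ->
  hausdorff_measure 1 [set (x, g x) | x in P] = 0%E.
Proof.
move=> mP P0 L0 gL; apply: hausdorff_measure_eq0 => d e d0 e0.
have L1 : 0 < 1 + L by rewrite ltr_pwDl.
set m := Num.min d e / (1 + L).
have m0 : 0 < m by rewrite divr_gt0// lt_min d0.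
have : ereal_inf [set (\sum_(0 <= k <oo) wlength idfun (F k))%E
    | F in open_itv_cover P] = 0%E.
  rewrite -outer_measure_open_itv_cover; apply/negligible_outer_measure.
  exact/negligibleP.
move=> inf0; have : (ereal_inf [set (\sum_(0 <= k <oo) wlength idfun (F k))%E
    | F in open_itv_cover P] < m%:E)%E by rewrite inf0 lte_fin.
move=> /ereal_inf_lt[_ [F [Fi PF] <-] Fm].
pose U k := [set (x, g x) | x in P `&` F k].
have AU : [set (x, g x) | x in P] `<=` \bigcup_k U k.
  move=> _ [x Px <-]; have [k _ Fk] := PF _ Px; exists k => //.
  by exists x.
have w0 k : (0 <= wlength idfun (F k))%E by exact: wlength_ge0.
have wm k : (wlength idfun (F k) <= m%:E)%E.
  apply: le_trans (ltW Fm); rewrite (@nneseriesD1 _ _ k)// leeDl//.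
  exact: nneseries_ge0.
pose r k := (1 + L) * fine (wlength idfun (F k)).
have rE k : (r k)%:E = ((1 + L)%:E * wlength idfun (F k))%E.
  rewrite /r EFinM fineK// ge0_fin_numE//; exact: le_lt_trans (wm k) (ltry _).
have r0 k : 0 <= r k by rewrite -lee_fin rE mule_ge0// lee_fin ltW.
have Ur k : (eucl_diam (U k) <= (r k)%:E)%E.
  apply: eucl_diam_le => // _ _ [x [Px Fx] <-] [y [Py Fy] <-].
  have [[a b] Fk] := Fi k; move: Fx Fy; rewrite Fk/= !in_itv/=.
  move=> /andP[ax xb] /andP[ay yb].
  apply: le_trans (eucl_dist_le _ _) _ => /=.
  rewrite /r Fk wlength_itv_bnd ?(ltW (lt_trans ax xb))//=.
  have xy : `|x - y| <= b - a by rewrite ler_norml; apply/andP; split; lra.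
  apply: le_trans (_ : (1 + L) * `|x - y| <= _); last by rewrite ler_pM2l.
  by rewrite mulrDl mul1r lerD2l; exact: gL.
apply: (le_trans (hausdorff_premeasure_le 1 AU (d := d) _)).
  move=> k; apply: le_trans (Ur k) _; rewrite rE.
  apply: (@le_trans _ _ ((1 + L)%:E * m%:E)%E).
    by apply: lee_pmul => //; rewrite lee_fin ltW.
  by rewrite -EFinM lee_fin /m mulrC divfK ?gt_eqF// ge_min lexx.
apply: (@le_trans _ _ (\sum_(0 <= k <oo) (1 + L)%:E * wlength idfun (F k))%E).
  apply: lee_nneseries => [k _ _|k _]; first exact: hausdorff_gauge_ge0.
  by rewrite -rE -[X in (_ <= X%:E)%E]powRr1//; exact: hausdorff_gauge_le.
rewrite nneseriesZl//; apply: (@le_trans _ _ ((1 + L)%:E * m%:E)%E).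
  by apply: lee_wpmul2l; [rewrite lee_fin ltW|exact: ltW].
by rewrite -EFinM lee_fin /m mulrC divfK ?gt_eqF// ge_min lexx orbT.
Qed.

(** * Dyadic squares, discrete Frostman measures and their energy *)

(** Index of the half-open dyadic square of side 2 ^ (- k) containing x. *)
Definition dyadic_cell (R : realType) (k : nat) (x : R * R) : int * int :=
  (Num.floor (2 ^+ k * x.1), Num.floor (2 ^+ k * x.2)).

Lemma floor_half (R : realType) (x y : R) :
  Num.floor (2 * x) = Num.floor (2 * y) -> Num.floor x = Num.floor y.
Proof.
move=> e; apply/esym/eqP; rewrite floor_eq.
have /andP[x1 x2] := floor_itv x.
have l1 : Num.floor x + Num.floor x <= Num.floor (2 * x).
  by rewrite floor_ge_int intrD; lra.
have l2 : Num.floor (2 * x) < (Num.floor x + 1) + (Num.floor x + 1).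
  by rewrite floor_lt_int !intrD in x2 *; lra.
move: l1 l2; rewrite e floor_ge_int floor_lt_int !intrD => ? ?.
by apply/andP; split; lra.
Qed.

Lemma dyadic_cell_nested (R : realType) (k : nat) (x y : R * R) :
  dyadic_cell k.+1 x = dyadic_cell k.+1 y -> dyadic_cell k x = dyadic_cell k y.
Proof.
rewrite /dyadic_cell !exprS -!mulrA => -[e1 e2].
by rewrite (floor_half e1) (floor_half e2).
Qed.

Lemma dist_of_floor (R : realType) (k : nat) (x y : R) :
  Num.floor (2 ^+ k * x) = Num.floor (2 ^+ k * y) -> `|x - y| <= 2^-1 ^+ k.
Proof.
move=> e; have /andP[x1 x2] := floor_itv (2 ^+ k * x).
have /andP[y1 y2] := floor_itv (2 ^+ k * y).
have p0 : 0 < 2 ^+ k :> R by rewrite exprn_gt0.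
have E : 2 ^+ k * `|x - y| = `|2 ^+ k * x - 2 ^+ k * y|.
  by rewrite -mulrBr normrM (gtr0_norm p0).
rewrite exprVn -(ler_pM2l p0) mulfV ?gt_eqF// E.
move: x1 x2 y1 y2; rewrite e intrD => ? ? ? ?.
by rewrite ler_norml; apply/andP; split; lra.
Qed.

Lemma dyadic_cell_dist (R : realType) (k : nat) (x y : R * R) :
  dyadic_cell k x = dyadic_cell k y -> `|x - y| <= 2^-1 ^+ k.
Proof.
move=> [/dist_of_floor ? /dist_of_floor ?].
by rewrite prod_normE ge_max; apply/andP.
Qed.

(** The five shifts are - 2, ..., 2, encoded by 0, ..., 4. *)
Lemma floor_near (R : realType) (k : nat) (x y : R) :
  `|x - y| <= 2 * 2^-1 ^+ k -> exists p : 'I_5,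
  Num.floor (2 ^+ k * y) = Num.floor (2 ^+ k * x) + p%:Z - 2.
Proof.
have p0 : 0 < 2 ^+ k :> R by rewrite exprn_gt0.
have E : 2 ^+ k * `|x - y| = `|2 ^+ k * x - 2 ^+ k * y|.
  by rewrite -mulrBr normrM (gtr0_norm p0).
rewrite exprVn -(ler_pM2l p0) mulrCA mulfV ?gt_eqF// E mulr1.
set u := _ * x; set v := _ * y => uv.
have /andP[x1 x2] := floor_itv u; have /andP[y1 y2] := floor_itv v.
have [d1 d2] : -3 < Num.floor v - Num.floor u /\ Num.floor v - Num.floor u < 3.
  move: uv x1 x2 y1 y2; rewrite ler_norml !intrD => /andP[? ?] ? ? ? ?.
  by split; rewrite -(ltr_int R) intrB/=; lra.
have d3 : 0 <= Num.floor v - Num.floor u + 2 by lia.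
have d4 : (absz (Num.floor v - Num.floor u + 2)%R < 5)%N by lia.
by exists (Ordinal d4) => /=; lia.
Qed.

(** A square of half-side 2 * 2 ^ (- k) meets at most 25 dyadic squares of side
2 ^ (- k). *)
Lemma ball_mass (R : realType) (I : finType) (x : I -> R * R) (w : I -> R)
    (k : nat) (m : R) (y : R * R) :
  (forall i, 0 <= w i) ->
  (forall c, \sum_(j | dyadic_cell k (x j) == c) w j <= m) ->
  \sum_(j | `|y - x j| <= 2 * 2^-1 ^+ k) w j <= 25 * m.
Proof.
move=> w0 H.
pose c (p : 'I_5 * 'I_5) : int * int :=
  ((dyadic_cell k y).1 + p.1%:Z - 2, (dyadic_cell k y).2 + p.2%:Z - 2).
apply: le_trans (_ : \sum_p \sum_(j | dyadic_cell k (x j) == c p) w j <= _).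
  rewrite (exchange_big_dep xpredT)//= big_mkcond/=; apply: ler_sum => j _.
  case: ifPn => [|_]; last exact: sumr_ge0.
  rewrite prod_normE ge_max => /andP[/floor_near[p ep] /floor_near[q eq]].
  rewrite (bigD1 (p, q)) ?lerDl ?sumr_ge0//.
  by apply/eqP; rewrite /dyadic_cell ep eq.
apply: (@le_trans _ _ (\sum_(p : 'I_5 * 'I_5) m)).
  by apply: ler_sum => p _; exact: H.
by rewrite sumr_const card_prod card_ord mulr_natl.
Qed.

Lemma powR_half_lt (R : realType) (s : R) : 1 < s -> 2^-1 `^ s < 2^-1 :> R.
Proof.
move=> s1; rewrite -[s](subrK 1) addrC powRD; last first.
  by rewrite invr_eq0 pnatr_eq0 implybT.
rewrite powRr1 ?invr_ge0// -[X in _ < X]mulr1 ltr_pM2l ?invr_gt0//.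
have s10 : 0 < s - 1 by rewrite subr_gt0.
have := gt0_ltr_powR s10 (x := 2^-1) (y := 1).
rewrite !nnegrE invr_ge0 ler0n ler01 powR1; apply=> //.
by rewrite invf_lt1// ltr1n.
Qed.

Lemma powR_half_exp (R : realType) (s : R) (k : nat) :
  (2^-1 ^+ k) `^ s = (2^-1 `^ s) ^+ k :> R.
Proof. by rewrite -!powR_mulrn ?powR_ge0 ?invr_ge0// powRAC. Qed.

Lemma hausdorff_premeasure_le_seq (R : realType) (s d : R) (A : set (R * R))
    (D : eqType) (l : seq D) (U : D -> set (R * R)) :
  0 <= d -> (forall x, A x -> exists2 c, c \in l & U c x) ->
  (forall c, c \in l -> (eucl_diam (U c) <= d%:E)%E) ->
  (hausdorff_premeasure s d A <= \sum_(c <- l) hausdorff_gauge s (U c))%E.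
Proof.
move=> d0 AU Ud.
(* The finite cover is continued by empty sets, whose gauge is 0. *)
pose V i := nth set0 (map U l) i.
have g0 : hausdorff_gauge s (set0 : set (R * R)) = 0%E.
  by rewrite /hausdorff_gauge eqxx.
apply: le_trans (_ : (\sum_(0 <= k <oo) hausdorff_gauge s (V k) <= _)%E).
  apply: hausdorff_premeasure_le.
    move=> x /AU[c cl Ucx]; exists (index c l) => //.
    by rewrite /V (nth_map c) ?index_mem// nth_index.
  move=> k; have [kl|lk] := ltnP k (size l).
    have [c cl ->] : exists2 c, c \in l & V k = U c.
      case: l kl @V {AU Ud} => // c l kl V; exists (nth c (c :: l) k).
        exact: mem_nth.
      by rewrite /V (nth_map c).
    exact: Ud.
  rewrite /V nth_default ?size_map//; exact: eucl_diam_le.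
rewrite (nneseries_split _ (size l)) => [|k _]; last exact: hausdorff_gauge_ge0.
rewrite add0n eseries0 => [|i li _]; last first.
  by rewrite /V nth_default ?size_map// g0.
by rewrite adde0 -(big_map U xpredT (hausdorff_gauge s)) (big_nth set0) size_map.
Qed.

(** Frostman's lemma at scale 2 ^ (- k0 - n), where neither k0 nor the total mass
W depends on n. The squares produced by [frostman_cover], slightly enlarged,
cover E with diameters at most d0 once 6 * 2 ^ (- k0) <= d0. The sum of their
gauges is at most 6 ^ s times the total weight, and at least the premeasure, so
the total weight is at least c / 6 ^ s. The weights are then scaled down to make the total mass the same
for all n. *)
Lemma discrete_frostman (R : realType) (E : set (R * R)) (s d0 c : R) :
  compact E -> 0 <= s -> 0 < d0 -> 0 < c ->
  (c%:E <= hausdorff_premeasure s d0 E)%E ->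
  exists (k0 : nat) (W : R), 0 < W /\ forall n, exists (m : nat)
    (x : 'I_m -> R * R) (w : 'I_m -> R), [/\ forall i, E (x i),
    forall i, 0 <= w i, \sum_i w i = W &
    forall k a, (k <= n)%N ->
      \sum_(j | dyadic_cell (k0 + k) (x j) == a) w j <=
        (2^-1 `^ s) ^+ (k0 + k)].
Proof.
move=> cE s0 d00 c0 Hc.
have h1 : 2^-1 < 1 :> R by rewrite invf_lt1// ltr1n.
have h0 : 0 < 2^-1 :> R by rewrite invr_gt0.
have [k0 k0d] : exists k0, 6 * 2^-1 ^+ k0 <= d0 :> R.
  have nh1 : `|2^-1| < 1 :> R by rewrite gtr0_norm.
  have d60 : 0 < d0 / 6 by rewrite divr_gt0.
  have /cvgrPdist_lt/(_ _ d60)[] := cvg_expr nh1.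
  move=> k0 _ /(_ k0 (leqnn k0)); rewrite sub0r normrN => h.
  exists k0; rewrite mulrC -ler_pdivlMr//.
  by rewrite ltW// (le_lt_trans (ler_norm _) h).
set th := 2^-1 `^ s; have th0 : 0 < th by exact: powR_gt0.
have p60 : 0 < 6 `^ s :> R by exact: powR_gt0.
exists k0, (c / 6 `^ s); split; first exact: divr_gt0.
move=> n.
have rn0 : 0 < 2^-1 ^+ (k0 + n) :> R by rewrite exprn_gt0.
have [l [lE El]] := finite_net cE rn0.
pose x (i : 'I_(size l)) := nth (0, 0) l i.
have cap0 k : 0 < th ^+ (k0 + k) by rewrite exprn_gt0.
have nest k i j : dyadic_cell (k0 + k.+1) (x i) = dyadic_cell (k0 + k.+1) (x j) ->
    dyadic_cell (k0 + k) (x i) = dyadic_cell (k0 + k) (x j).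
  by rewrite addnS; exact: dyadic_cell_nested.
have [w [D [w0 w1 w2 w3]]] := frostman_cover n cap0 nest.
set W := \sum_i w i in w3.
have cW : c / 6 `^ s <= W.
  pose D' := [seq a <- D | (a.1 <= n)%N].
  (* The cells only cover the net; enlarged by its mesh they cover E. *)
  pose U (a : nat * (int * int)) := [set y |
    exists2 i, dyadic_cell (k0 + a.1) (x i) = a.2
             & `|x i - y| < 2^-1 ^+ (k0 + n)].
  have Ud a : a \in D' -> (eucl_diam (U a) <= (6 * 2^-1 ^+ (k0 + a.1))%:E)%E.
    rewrite mem_filter => /andP[an _].
    apply: eucl_diam_le; first by rewrite mulr_ge0// exprn_ge0.
    move=> y z [i ei yi] [j ej zj].
    have ij := dyadic_cell_dist (etrans ei (esym ej)).
    have le : 2^-1 ^+ (k0 + n) <= 2^-1 ^+ (k0 + a.1) :> R.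
      by rewrite ler_wiXn2l// ?ltW// leq_add2l.
    have yz : `|y - z| <= 3 * 2^-1 ^+ (k0 + a.1).
      rewrite (_ : y - z = (x i - x j) - (x i - y) + (x j - z)); last first.
        by rewrite opprB (addrC (x i - x j)) !subrKA.
      apply: (le_trans (ler_normD _ _)).
      apply: (le_trans (lerD (ler_normB _ _) (lexx _))).
      by lra.
    apply: (le_trans (eucl_dist_le _ _)); move: yz.
    by rewrite prod_normE ge_max/= => /andP[? ?]; lra.
  have H : (hausdorff_premeasure s d0 E <= \sum_(a <- D') hausdorff_gauge s (U a))%E.
    apply: hausdorff_premeasure_le_seq; first exact: ltW.
      move=> y /El[z zl zy].
      have zi : (index z l < size l)%N by rewrite index_mem.
      have [k kn kD] := w2 (Ordinal zi).
      exists (k, dyadic_cell (k0 + k) (x (Ordinal zi))).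
        by rewrite mem_filter kn.
      by exists (Ordinal zi) => //; rewrite /x/= nth_index.
    move=> a aD; apply: (le_trans (Ud a aD)); rewrite lee_fin.
    apply: le_trans k0d; rewrite ler_pM2l//.
    by rewrite ler_wiXn2l// ?ltW// leq_addr.
  rewrite ler_pdivrMr//.
  rewrite -lee_fin; apply: (le_trans Hc); apply: (le_trans H).
  apply: (@le_trans _ _ (\sum_(a <- D') (6 `^ s * th ^+ (k0 + a.1))%:E)%E).
    rewrite big_seq [X in (_ <= X)%E]big_seq; apply: lee_sum => a aD.
    rewrite -powR_half_exp -powRM ?exprn_ge0 ?invr_ge0//.
    apply: hausdorff_gauge_le; [by []| |exact: Ud].
    by rewrite mulr_ge0// exprn_ge0// invr_ge0.
  rewrite sumEFin lee_fin -mulr_sumr mulrC ler_wpM2r ?(ltW p60)// -w3 big_filter.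
  rewrite [X in _ <= X](bigID (fun a => (a.1 <= n)%N))/= lerDl sumr_ge0// => a _.
  exact/ltW/cap0.
have W0 : 0 < W by apply: lt_le_trans cW; exact: divr_gt0.
set q := c / 6 `^ s / W.
have q0 : 0 <= q by rewrite !divr_ge0// ltW.
have q1 : q <= 1 by rewrite ler_pdivrMr// mul1r.
exists (size l), x, (fun i => q * w i); split.
- by move=> i; apply: lE; rewrite mem_nth.
- by move=> i; rewrite mulr_ge0.
- by rewrite -mulr_sumr -/W divfK// gt_eqF.
- move=> k a kn; apply: le_trans (w1 k a kn).
  by apply: ler_sum => j _; rewrite ler_piMl.
Qed.

(** Dyadic decomposition of 1 / max(d, 2 ^ (- k0 - n)), by induction on n: either d
is below the new scale, and the new term alone is large enough, or the
maximum does not change. *)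
Lemma inv_max_dyadic (R : realType) (k0 n : nat) (d : R) :
  (Num.max d (2^-1 ^+ (k0 + n)))^-1 <=
  2 ^+ k0 + \sum_(k < n.+1 | d <= 2 * 2^-1 ^+ (k0 + k)) 2 ^+ (k0 + k).+1.
Proof.
have p0 m : 0 < 2^-1 ^+ m :> R by rewrite exprn_gt0// invr_gt0.
have inv m : (Num.max d (2^-1 ^+ m))^-1 <= 2 ^+ m.
  rewrite -[X in _ <= X]invrK -exprVn lef_pV2 ?posrE ?le_max ?lexx ?orbT//.
  by rewrite lt_max p0 orbT.
have s0 (m : nat) (P : pred 'I_m) : 0 <= \sum_(k < m | P k) 2 ^+ (k0 + k).+1 :> R.
  by apply: sumr_ge0 => k _; rewrite exprn_ge0.
elim: n => [|n IH].
  rewrite addn0; apply: le_trans (inv k0) _; rewrite lerDl; exact: s0.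
rewrite big_mkcond big_ord_recr -big_mkcond/=; case: ifPn => [_|].
  apply: le_trans (inv _) _; have S0 := s0 n.+1 (fun k => d <= 2 * 2^-1 ^+ (k0 + k)).
  have e0 : 0 <= 2 ^+ k0 :> R by rewrite exprn_ge0.
  have e1 : 0 <= 2 ^+ (k0 + n.+1) :> R by rewrite exprn_ge0.
  by rewrite exprS; lra.
rewrite -ltNge addr0 => h; apply: le_trans IH.
have E : 2 * 2^-1 ^+ (k0 + n.+1) = 2^-1 ^+ (k0 + n) :> R.
  by rewrite addnS exprS mulrA mulfV ?mul1r.
have h1 := p0 (k0 + n.+1)%N; rewrite E in h.
by rewrite !max_l//; lra.
Qed.

(** Summing over dyadic scales, the ball of radius 2 * 2 ^ (- k) has mass at most
25 th ^ k and is counted with factor 2 ^ (k + 1), which gives a geometric series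
of ratio 2 th < 1. The scales coarser than k0 contribute at most 2 ^ k0 times
the total mass. *)
Lemma discrete_energy (R : realType) (I : finType) (x : I -> R * R)
    (w : I -> R) (k0 n : nat) (th : R) (y : R * R) :
  0 < th -> th < 2^-1 -> (forall i, 0 <= w i) ->
  (forall k a, (k <= n)%N ->
    \sum_(j | dyadic_cell (k0 + k) (x j) == a) w j <= th ^+ (k0 + k)) ->
  \sum_j w j / Num.max `|y - x j| (2^-1 ^+ (k0 + n)) <=
  2 ^+ k0 * (\sum_i w i) + 50 / (1 - 2 * th).
Proof.
move=> th0 th1 w0 H.
have t1 : 0 < 1 - 2 * th by lra.
pose P k j := `|y - x j| <= 2 * 2^-1 ^+ (k0 + k).
apply: (@le_trans _ _ (\sum_j w j * (2 ^+ k0 +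
    \sum_(k < n.+1 | P k j) 2 ^+ (k0 + k).+1))).
  by apply: ler_sum => j _; rewrite ler_wpM2l// inv_max_dyadic.
under eq_bigr do rewrite mulrDr.
rewrite big_split/= -mulr_suml mulrC lerD2l.
under eq_bigr do rewrite mulr_sumr.
rewrite (exchange_big_dep xpredT)//=.
apply: (@le_trans _ _ (\sum_(k < n.+1) 50 * (2 * th) ^+ k)).
  apply: ler_sum => k _; rewrite -mulr_suml.
  apply: (@le_trans _ _ (25 * th ^+ (k0 + k) * 2 ^+ (k0 + k).+1)).
    rewrite ler_wpM2r ?exprn_ge0//; apply: ball_mass => // a.
    by apply: H; rewrite -ltnS.
  rewrite (_ : _ * _ = 50 * (2 * th) ^+ (k0 + k)); last first.
    by rewrite exprMn exprS; ring.
  rewrite ler_pM2l// exprD ler_piMl ?exprn_ge0 ?mulr_ge0 ?(ltW th0)//.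
  by rewrite exprn_ile1 ?mulr_ge0 ?(ltW th0)//; lra.
rewrite -mulr_sumr ler_pM2l// -[X in _ <= X]mul1r ler_pdivlMr//.
have q0 : 0 <= (2 * th) ^+ n.+1 by rewrite exprn_ge0 ?mulr_ge0 ?(ltW th0).
by have := subrX1 (2 * th) n.+1; set S := \sum_(i < _) _; lra.
Qed.

(** * Sums with a curved set have positive area *)

(** The closed vertical d-neighbourhood of x + A; written as a sum of compact
sets, it is visibly compact, hence measurable. *)
Definition graph_band (R : realType) (A : set (R * R)) (x : R * R) (d : R) :=
  minkowski_sum (minkowski_sum [set x] A) (vertical_segment d).

Lemma graph_bandE (R : realType) (P : set R) (g : R -> R) (x : R * R) (d u v : R) :
  graph_band [set (p, g p) | p in P] x d (u, v) <->
  P (u - x.1) /\ `|v - (x.2 + g (u - x.1))| <= d.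
Proof.
split.
  move=> [_ [_ -> [_ [p Pp <-] <-]] [_ [t tI <-] [<- <-]]] /=.
  rewrite addr0 addrAC subrr add0r; split=> //.
  rewrite addrAC subrr add0r ler_norml; by move: tI; rewrite /= in_itv.
move=> [Pu vd]; exists (x + (u - x.1, g (u - x.1))).
  exists x => //; exists (u - x.1, g (u - x.1)) => //; by exists (u - x.1).
exists (0, v - (x.2 + g (u - x.1))).
  by exists (v - (x.2 + g (u - x.1))) => //; rewrite /= in_itv/= -ler_norml.
by case: x {Pu vd} => a b /=; congr pair => /=; ring.
Qed.

(** The main estimate: the areas of the vertical neighbourhoods of E + A are
bounded below by the same m0 at every scale. *)
Lemma curve_sum_positive (R : realType) (E : set (R * R)) (P : set R)
    (a b c0 s : R) (g g1 g2 : R -> R) :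
  compact E -> 1 < s -> hausdorff_measure s E != 0%E ->
  a <= b -> C2_on a b g g1 g2 -> 0 < c0 ->
  (forall x, x \in `[a, b] -> c0 <= `|g2 x|) ->
  P `<=` `[a, b] -> compact [set (p, g p) | p in P] ->
  measurable (P : set (measurableTypeR R)) ->
  (0 < lebesgue_measure P)%E ->
  (0 < planar_lebesgue (minkowski_sum E [set (p, g p) | p in P]))%E.
Proof.
move=> cE s1 HE ab gC c00 g2c Pab cA mP P0.
set A := [set (p, g p) | p in P].
have s0 : 0 <= s by lra.
have [l l0 lP] : exists2 l, 0 < l & (l%:E <= lebesgue_measure P)%E.
  case: (lebesgue_measure P) P0 => [r| |//].
    by rewrite lte_fin => r0; exists r.
  by move=> _; exists 1 => //; rewrite leey.
have [d0 d00 Hd0] : exists2 d, 0 < d & (0 < hausdorff_premeasure s d E)%E.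
  apply: contrapT => h; move/negP: HE; apply; apply/eqP.
  apply: hausdorff_measure_eq0 => d e d0 e0.
  apply: (@le_trans _ _ 0%E); last by rewrite lee_fin ltW.
  by rewrite leNgt; apply/negP => Hd; apply: h; exists d.
have [c cpos cH] : exists2 c, 0 < c & (c%:E <= hausdorff_premeasure s d0 E)%E.
  case: (hausdorff_premeasure s d0 E) Hd0 => [r| |//].
    by rewrite lte_fin => r0; exists r.
  by move=> _; exists 1 => //; rewrite leey.
have [k0 [W [W0 HW]]] := discrete_frostman cE s0 d00 cpos cH.
have [L L0 gL] := C2_lipschitz gC.
set th := 2^-1 `^ s in HW.
have th0 : 0 < th by rewrite powR_gt0// invr_gt0.
have th1 : th < 2^-1 by exact: powR_half_lt.
pose C := 4 * (1 + L) / c0 + 3 * (b - a).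
have C0 : 0 < C.
  rewrite /C ltr_pwDl ?mulr_ge0 ?subr_ge0// divr_gt0// mulr_gt0//.
  by rewrite ltr_pwDl.
pose K := 2 ^+ k0 * W + 50 / (1 - 2 * th).
have K0 : 0 < K by rewrite /K addr_gt0// ?mulr_gt0 ?exprn_gt0// invr_gt0; lra.
(* Cauchy-Schwarz with parameter tau * d reads
   4 tau l W d^2 <= 4 C K W d^2 + tau^2 d^2 |S|; this tau makes the left-hand side
   twice the first term on the right. *)
pose tau := 2 * C * K / l.
have tau0 : 0 < tau by rewrite /tau divr_gt0// !mulr_gt0.
have tl : tau * l = 2 * C * K by rewrite /tau divfK// gt_eqF.
clearbody tau.
pose m0 := 4 * C * K * W / tau ^+ 2.
have m00 : 0 < m0 by rewrite /m0 divr_gt0 ?exprn_gt0// !mulr_gt0.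
have cEA : compact (minkowski_sum E A) by exact: compact_minkowski.
apply: (@lt_le_trans _ _ m0%:E); first by rewrite lte_fin.
have h0 : 0 < 2^-1 ^+ k0 :> R by rewrite exprn_gt0// invr_gt0.
apply: (planar_lebesgue_thickening cEA h0) => n.
rewrite -exprD; set d := 2^-1 ^+ (k0 + n).
have dpos : 0 < d by rewrite exprn_gt0// invr_gt0.
have [m [x [w [xE w0 wW Hw]]]] := HW n.
pose N i := graph_band A (x i) d.
set S := minkowski_sum _ _.
have cS : compact S.
  by apply: compact_minkowski => //; exact: compact_vertical_segment.
have cN i : compact (N i).
  apply: compact_minkowski; last exact: compact_vertical_segment.
  by apply: compact_minkowski => //; exact: compact_set1.
have NS i : N i `<=` S.
  move=> _ [_ [_ -> [y Ay <-]] [t Tt <-]]; exists (x i + y); last by exists t.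
  by exists (x i) => //; exists y.
have Nlow i : ((2 * d * l)%:E <= planar_lebesgue (N i))%E.
  have mQ : measurable ([set u | P (u - (x i).1)] : set (measurableTypeR R)).
    have mf : measurable_fun setT
        ((fun u => u - (x i).1) : measurableTypeR R -> measurableTypeR R).
      by apply: measurable_funB => //; exact: measurable_cst.
    by have := mf measurableT _ mP; rewrite setTI.
  apply: le_trans (planar_section_lower (h := fun u => (x i).2 + g (u - (x i).1))
    (cN i) mQ (ltW dpos) _).
    rewrite lebesgue_translate// EFinM; apply: lee_wpmul2l => //.
    by rewrite lee_fin mulr_ge0// ltW.
  by move=> u Pu v uv; apply/graph_bandE.
have Nup i j : (planar_lebesgue (N i `&` N j) <=
    (4 * C * d ^+ 2 / Num.max `|x i - x j| d)%:E)%E.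
  have M0 : 0 < Num.max `|x i - x j| d by rewrite lt_max dpos orbT.
  rewrite (_ : _ / _ = 2 * d * (2 * (C * d / Num.max `|x i - x j| d))); last first.
    by rewrite expr2; field; rewrite gt_eqF.
  apply: (@planar_section_upper _ _ _ _ (fun u => (x i).2 + g (u - (x i).1))).
  - apply: compact_closedI => //; apply: compact_closed => //; exact: norm_hausdorff.
  - exact: ltW.
  - by rewrite divr_ge0 ?(ltW M0)// mulr_ge0// ltW.
  - by move=> u v [/graph_bandE[]].
  move=> u v u' v' [/graph_bandE[ui vi] /graph_bandE[uj vj]].
  move=> [/graph_bandE[u'i v'i] /graph_bandE[u'j v'j]].
  rewrite ler_pdivlMr//; apply: (translates_overlap gC c00 g2c L0 gL).
  - exact: Pab.
  - exact: Pab.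
  - exact: Pab.
  - exact: Pab.
  - move: vi vj; rewrite !ler_norml => /andP[? ?] /andP[? ?].
    by apply/andP; split; lra.
  - move: v'i v'j; rewrite !ler_norml => /andP[? ?] /andP[? ?].
    by apply/andP; split; lra.
have CS := @overlap_cauchy_schwarz _ _ _ (lebesgue_measure \x lebesgue_measure)%E
  _ N S w (tau * d) (fun i => compact_plane_measurable (cN i))
  (compact_plane_measurable cS) NS w0 (mulr_ge0 (ltW tau0) (ltW dpos)).
have low : ((4 * tau * d ^+ 2 * l * W)%:E <=
    \sum_i (2 * (tau * d) * w i)%:E * planar_lebesgue (N i))%E.
  apply: (@le_trans _ _ (\sum_i (2 * (tau * d) * w i)%:E * (2 * d * l)%:E)%E).
    under eq_bigr do rewrite -EFinM.
    rewrite sumEFin lee_fin -mulr_suml -mulr_sumr wW le_eqVlt; apply/orP; left.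
    by apply/eqP; ring.
  apply: lee_sum => i _; apply: lee_wpmul2l => //.
  by rewrite lee_fin !mulr_ge0 ?(ltW tau0) ?(ltW dpos)//.
have up : (\sum_(p : 'I_m * 'I_m) (w p.1 * w p.2)%:E *
    planar_lebesgue (N p.1 `&` N p.2) <= (4 * C * d ^+ 2 * K * W)%:E)%E.
  apply: (@le_trans _ _ (\sum_(p : 'I_m * 'I_m) (w p.1 * w p.2)%:E *
    (4 * C * d ^+ 2 / Num.max `|x p.1 - x p.2| d)%:E)%E).
    apply: lee_sum => p _; apply: lee_wpmul2l; last exact: Nup.
    by rewrite lee_fin !mulr_ge0.
  under eq_bigr do rewrite -EFinM.
  rewrite sumEFin lee_fin.
  rewrite -(pair_bigA _ (fun i j => w i * w j *
     (4 * C * d ^+ 2 / Num.max `|x i - x j| d)))/=.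
  apply: (@le_trans _ _ (\sum_i w i * (4 * C * d ^+ 2 * K))); last first.
    by rewrite -mulr_suml wW mulrC.
  apply: ler_sum => i _.
  rewrite (_ : \sum_j _ = w i * (4 * C * d ^+ 2 *
      \sum_j w j / Num.max `|x i - x j| d)); last first.
    by rewrite !mulr_sumr; apply: eq_bigr => j _; ring.
  rewrite ler_wpM2l// ler_wpM2l ?mulr_ge0 ?exprn_ge0 ?(ltW C0) ?(ltW dpos)//.
  have := discrete_energy (x i) th0 th1 w0 Hw; rewrite wW; exact.
have main : ((4 * tau * d ^+ 2 * l * W)%:E <=
    (4 * C * d ^+ 2 * K * W)%:E + ((tau * d) ^+ 2)%:E * planar_lebesgue S)%E.
  exact: (le_trans low (le_trans CS (leeD up (lexx _)))).
have S0 : (0 <= planar_lebesgue S)%E by exact: measure_ge0.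
case: (planar_lebesgue S) S0 main => [q _| |].
- rewrite -EFinM -EFinD !lee_fin => h.
  rewrite /m0 ler_pdivrMr ?exprn_gt0//.
  have d20 : 0 < d ^+ 2 by rewrite exprn_gt0.
  rewrite -(ler_pM2l d20).
  have e1 : 4 * tau * d ^+ 2 * l * W = d ^+ 2 * (8 * C * K * W).
    have -> : 8 * C * K = 4 * (tau * l) by rewrite tl; ring.
    ring.
  by move: h; rewrite e1; lra.
- by move=> *; rewrite leey.
- by rewrite leeNy_eq.
Qed.

(** * Cantor sets of prescribed dimension *)

(** Left endpoints of the 2 ^ n intervals of length r ^ n of the n-th step of the
construction. *)
Fixpoint cantor_endpoints (R : realType) (r : R) (n : nat) : seq R :=
  if n is m.+1 then
    [seq r * a | a <- cantor_endpoints r m] ++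
    [seq (1 - r) + r * a | a <- cantor_endpoints r m]
  else [:: 0].

Definition cantor_step (R : realType) (r : R) (n : nat) : set R :=
  \bigcup_(a in [set` cantor_endpoints r n]) `[a, a + r ^+ n]%classic.

Definition cantor_set (R : realType) (r : R) : set R :=
  \bigcap_n cantor_step r n.

Lemma cantor_step_left (R : realType) (r : R) (n : nat) (t : R) :
  0 < r -> cantor_step r n t -> cantor_step r n.+1 (r * t).
Proof.
move=> r0 [a /= aL]; rewrite /= in_itv/= => /andP[at_ ta].
exists (r * a); first by rewrite /= mem_cat map_f.
by rewrite /= in_itv/= exprS -mulrDr !ler_pM2l// at_.
Qed.

Lemma cantor_step_right (R : realType) (r : R) (n : nat) (t : R) :
  0 < r -> cantor_step r n t -> cantor_step r n.+1 ((1 - r) + r * t).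
Proof.
move=> r0 [a /= aL]; rewrite /= in_itv/= => /andP[at_ ta].
exists ((1 - r) + r * a).
  by rewrite /= mem_cat (map_f (fun a => (1 - r) + r * a)) ?orbT.
have := ler_pM2l r0 a t; have := ler_pM2l r0 t (a + r ^+ n).
by rewrite at_ ta mulrDr /= in_itv/= exprS => ? ?; apply/andP; split; lra.
Qed.

Lemma compact_cantor_set (R : realType) (r : R) : compact (cantor_set r).
Proof.
apply: (subclosed_compact _ (@segment_compact R 0 1)); last first.
  by move=> t /(_ 0%N I)[a /= ]; rewrite inE => /eqP ->; rewrite add0r.
apply: closed_bigI => n _; apply: closed_bigcup; first exact: finite_seq.
by move=> a _; exact: itv_closed.
Qed.

Lemma cantor_set_null (R : realType) (r : R) :
  0 < r -> r < 2^-1 -> lebesgue_measure (cantor_set r) = 0%E.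
Proof.
move=> r0 r12.
have mC : measurable (cantor_set r : set (measurableTypeR R)).
  by apply: compact_measurable; exact: compact_cantor_set.
have mI (a c : R) : measurable (`[a, c]%classic : set (measurableTypeR R)).
  exact: measurable_itv.
have H n : (lebesgue_measure (cantor_set r) <= ((2 * r) ^+ n)%:E)%E.
  have sz : size (cantor_endpoints r n) = (2 ^ n)%N.
    elim: n => //= n IH; by rewrite size_cat !size_map IH addnn -mul2n expnS.
  apply: (@le_trans _ _ (lebesgue_measure (cantor_step r n))).
    apply: le_measure; rewrite ?inE//; last by move=> t; apply.
    apply: fin_bigcup_measurable; first exact: finite_seq.
    by move=> a _; exact: mI.
  rewrite /cantor_step bigcup_seq exprMn -natrX -sz mulr_natl {sz}.
  elim: (cantor_endpoints r n) => [|a l IH]; first by rewrite big_nil measure0.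
  rewrite big_cons; apply: le_trans (measureU2 _ _ _) _ => //.
    by apply: bigsetU_measurable => b _; exact: mI.
  rewrite [size _]/= mulrS EFinD; apply: leeD => //.
  rewrite [X in (X <= _)%E](@lebesgue_measure_itv R `[a, a + r ^+ n])/= lte_fin.
  case: ifP => _; last by rewrite lee_fin exprn_ge0// ltW.
  by rewrite -EFinB lee_fin addrAC subrr add0r.
apply/eqP; rewrite eq_le measure_ge0 andbT.
apply/lee_addgt0Pr => e e0; rewrite add0e.
have q1 : `|2 * r| < 1 by rewrite gtr0_norm ?mulr_gt0//; lra.
have /cvgrPdist_lt/(_ _ e0)[n _ /(_ n (leqnn n))] := cvg_expr q1.
rewrite sub0r normrN => hn; apply: le_trans (H n) _.
by rewrite lee_fin ltW// (le_lt_trans (ler_norm _) hn).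
Qed.

Definition doubling (R : realType) (y : R) : R :=
  if y < 2^-1 then 2 * y else 2 * y - 1.

(** The first n digits of y in base 2, read in the Cantor expansion of ratio r.
The recursion consumes the leading digit, so that [cantor_point] inherits the
self-similarity of the Cantor set. *)
Fixpoint cantor_approx (R : realType) (r : R) (n : nat) (y : R) : R :=
  if n is m.+1 then
    (if y < 2^-1 then 0 else 1 - r) + r * cantor_approx r m (doubling y)
  else 0.

Definition cantor_point (R : realType) (r y : R) : R :=
  limn (fun n => cantor_approx r n y).

Lemma cantor_approx_cvg (R : realType) (r y : R) : 0 < r -> r < 1 ->
  (fun n => cantor_approx r n y) @ \oo --> cantor_point r y.
Proof.
move=> r0 r1; apply: nondecreasing_is_cvgn.
  apply/nondecreasing_seqP => n; elim: n y => [|n IH] y /=.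
    by rewrite mulr0 addr0; case: ifP => // _; rewrite subr_ge0 ltW.
  by rewrite lerD2l ler_pM2l//; exact: IH.
exists 1 => _ [n _ <-]; elim: n y => [|n IH] y //=.
have := IH (doubling y); rewrite -(ler_pM2l r0) mulr1.
by case: ifP => _ ?; lra.
Qed.

Lemma cantor_pointE (R : realType) (r y : R) : 0 < r -> r < 1 ->
  cantor_point r y =
    (if y < 2^-1 then 0 else 1 - r) + r * cantor_point r (doubling y).
Proof.
move=> r0 r1.
have h1 : (fun n => cantor_approx r n.+1 y) @ \oo --> cantor_point r y.
  by rewrite (cvg_shiftS (fun n => cantor_approx r n y)); exact: cantor_approx_cvg.
rewrite -[LHS](cvg_lim _ h1)//; apply: cvg_lim => //=.
apply: cvgD; first exact: cvg_cst.
by apply: cvgM; [exact: cvg_cst|exact: cantor_approx_cvg].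
Qed.

Lemma cantor_point_itv (R : realType) (r y : R) : 0 < r -> r < 1 ->
  0 <= cantor_point r y <= 1.
Proof.
move=> r0 r1; have cv := @cantor_approx_cvg _ r y r0 r1.
have H n : forall y, 0 <= cantor_approx r n y <= 1.
  elim: n => [|n IH] z /=; first by rewrite lexx ler01.
  have /andP[h0 h1] := IH (doubling z).
  have g0 : 0 <= r * cantor_approx r n (doubling z) by rewrite mulr_ge0// ltW.
  have g1 : r * cantor_approx r n (doubling z) <= r by rewrite ler_piMr// ltW.
  by case: ifP => _; apply/andP; split; lra.
have cv' : cvgn (fun n => cantor_approx r n y) by apply/cvg_ex; eexists; exact: cv.
apply/andP; split; [apply: limr_ge|apply: limr_le] => //;
  by apply: nearW => n; have /andP[] := H n y.
Qed.

Lemma doubling_itv (R : realType) (y : R) : 0 <= y < 1 -> 0 <= doubling y < 1.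
Proof.
by move=> /andP[y0 y1]; rewrite /doubling; case: ltP => h; apply/andP; split; lra.
Qed.

Lemma cantor_point_in (R : realType) (r y : R) : 0 < r -> r < 1 ->
  0 <= y < 1 -> cantor_set r (cantor_point r y).
Proof.
move=> r0 r1 yI n _; elim: n y yI => [|n IH] y yI.
  exists 0; first by rewrite /= inE.
  by rewrite /= in_itv/= expr0 add0r; exact: cantor_point_itv.
rewrite cantor_pointE//; case: ifP => _.
  by rewrite add0r; apply: cantor_step_left => //; exact/IH/doubling_itv.
by apply: cantor_step_right => //; exact/IH/doubling_itv.
Qed.

(** With r = 2 ^ (- p) the inequality is invariant under the doubling map, which
multiplies t ^ p by 1 / r. Doubling y and z until they lie in different halves
of [0, 1[ (this happens since their distance doubles each time) reduces it to
the gap 1 - 2 r between the two halves of the Cantor set. *)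
Lemma cantor_point_expands (R : realType) (p r y z : R) :
  1 < p -> r = 2^-1 `^ p -> r < 2^-1 -> 0 <= y -> y < z -> z < 1 ->
  (1 - 2 * r) * (z - y) `^ p <= cantor_point r z - cantor_point r y.
Proof.
move=> p1 rE r12 y0 yz z1.
have r0 : 0 < r by rewrite rE powR_gt0// invr_gt0.
have r1 : r < 1 by lra.
have [n nyz] : exists n, 2^-1 ^+ n <= z - y.
  have h : `|2^-1| < 1 :> R by rewrite gtr0_norm ?invr_gt0//; lra.
  have zy0 : 0 < z - y by lra.
  have /cvgrPdist_lt/(_ _ zy0)[n _ /(_ n (leqnn n))] := cvg_expr h.
  rewrite sub0r normrN => hn; exists n.
  by rewrite ltW// (le_lt_trans (ler_norm _) hn).
elim: n y z y0 yz z1 nyz => [|n IH] y z y0 yz z1; first by rewrite expr0; lra.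
rewrite exprS => nyz.
rewrite (cantor_pointE z)// (cantor_pointE y)//.
have scale (t : R) : 0 <= t -> r * (2 * t) `^ p = t `^ p.
  move=> t0; rewrite rE -powRM ?invr_ge0// ?mulr_ge0// mulrA mulVf ?mul1r//.
have [y12|y12] := ltP y 2^-1; have [z12|z12] := ltP z 2^-1.
- have := IH (2 * y) (2 * z); rewrite /doubling y12 z12 => /(_ _ _ _ _) h.
  have {h} : (1 - 2 * r) * (2 * z - 2 * y) `^ p <=
      cantor_point r (2 * z) - cantor_point r (2 * y) by apply: h; lra.
  rewrite -mulrBr -(ler_pM2l r0) mulrCA scale; last lra.
  lra.
- have /andP[a0 a1] := cantor_point_itv (doubling y) r0 r1.
  have /andP[b0 b1] := cantor_point_itv (doubling z) r0 r1.
  have h : (z - y) `^ p <= 1.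
    have := @ge0_ler_powR _ p _ (z - y) 1.
    by rewrite !nnegrE powR1; apply; lra.
  have h1 : (1 - 2 * r) * (z - y) `^ p <= 1 - 2 * r by rewrite ler_piMr//; lra.
  have h2 : r * cantor_point r (doubling y) <= r by rewrite ler_piMr// ltW.
  have h3 : 0 <= r * cantor_point r (doubling z) by rewrite mulr_ge0// ltW.
  by lra.
- lra.
- have := IH (2 * y - 1) (2 * z - 1).
  rewrite /doubling !ltNge y12 z12 /= => /(_ _ _ _ _) h.
  have {h} : (1 - 2 * r) * (2 * z - 1 - (2 * y - 1)) `^ p <=
      cantor_point r (2 * z - 1) - cantor_point r (2 * y - 1) by apply: h; lra.
  rewrite (_ : 2 * z - 1 - (2 * y - 1) = 2 * (z - y)); last by ring.
  rewrite -(ler_pM2l r0) mulrCA scale; last lra.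
  lra.
Qed.

Definition vertical_cantor (R : realType) (r : R) : set (R * R) :=
  [set (0, t) | t in cantor_set r].

(** Mass distribution principle, with Lebesgue measure on the space of binary
addresses in place of a measure on the Cantor set: by expansion, the addresses
of the points in a set of diameter D fill an interval of length at most a
multiple of D ^ u. *)
Lemma vertical_cantor_premeasure (R : realType) (u r v : R) :
  0 < u -> u < 1 -> r = 2^-1 `^ u^-1 -> 0 <= v -> v <= u ->
  (((1 - 2 * r) `^ u / 2)%:E <=
    hausdorff_premeasure v 1 (vertical_cantor r))%E.
Proof.
move=> u0 u1 rE v0 vu.
have p1 : 1 < u^-1 by rewrite invf_gt1.
have r12 : r < 2^-1 by rewrite rE; exact: powR_half_lt.
have r0 : 0 < r by rewrite rE powR_gt0// invr_gt0.
have r1 : r < 1 by lra.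
set c := 1 - 2 * r; have c0 : 0 < c by rewrite /c; lra.
have cu0 : 0 < c `^ u by exact: powR_gt0.
apply: le_ereal_inf_tmp => _ [U [EU Ud ->]].
pose D k := fine (eucl_diam (U k)).
have DE k : eucl_diam (U k) = (D k)%:E.
  rewrite /D fineK// ge0_fin_numE ?eucl_diam_ge0//.
  exact: le_lt_trans (Ud k) (ltry _).
have D0 k : 0 <= D k by rewrite -lee_fin -DE eucl_diam_ge0.
have D1 k : D k <= 1 by rewrite -lee_fin -DE.
pose Y k := [set y | 0 <= y < 1 /\ U k (0, cantor_point r y)].
(* An empty set has gauge 0 even for exponent 0, so its radius must be 0. *)
pose rho k := if U k == set0 then 0 else (D k / c) `^ u.
have rho0 k : 0 <= rho k by rewrite /rho; case: ifP => // _; exact: powR_ge0.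
have close k y z : Y k y -> Y k z -> `|y - z| <= rho k.
  wlog yz : y z / y < z => [H Yy Yz|].
    have [yz|zy|->] := ltgtP y z; first exact: H.
      by rewrite distrC; exact: H.
    by rewrite subrr normr0.
  move=> [/andP[y0 y1] Uy] [/andP[z0 z1] Uz].
  have U0 : U k != set0 by apply/set0P; eexists; exact: Uy.
  rewrite /rho (negbTE U0) distrC gtr0_norm ?subr_gt0//.
  have := cantor_point_expands p1 rE r12 y0 yz z1.
  have /= := eucl_dist_ge (0, cantor_point r z) (0, cantor_point r y).
  rewrite prod_normE/= ge_max => /andP[_ h1] h2.
  have h3 : eucl_dist (0, cantor_point r z) (0, cantor_point r y) <= D k.
    by rewrite -lee_fin -DE; exact: eucl_diam_ub.
  have h4 : (z - y) `^ u^-1 <= D k / c.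
    rewrite ler_pdivlMr// mulrC; apply: le_trans h2 _; apply: le_trans h3.
    by apply: le_trans h1; exact: ler_norm.
  have -> : z - y = ((z - y) `^ u^-1) `^ u.
    by rewrite -powRrM mulVf ?gt_eqF// powRr1//; lra.
  by apply: ge0_ler_powR; rewrite ?nnegrE ?powR_ge0 ?divr_ge0 ?(ltW c0) ?(ltW u0).
pose J k : set (measurableTypeR R) :=
  if pselect (Y k !=set0) is left h
  then `[sval (cid h) - rho k, sval (cid h) + rho k]%classic
  else set0.
have mJ k : measurable (J k).
  by rewrite /J; case: pselect => // h; exact: measurable_itv.
have YJ k : Y k `<=` J k.
  move=> y Yy; rewrite /J; case: pselect => [h|[]]; last by exists y.
  rewrite /= in_itv/=; have := close k _ _ Yy (svalP (cid h)).
  by rewrite ler_norml => /andP[? ?]; apply/andP; split; lra.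
have lJ k : (lebesgue_measure (J k) <= (2 * rho k)%:E)%E.
  rewrite /J; case: pselect => h; last by rewrite measure0 lee_fin mulr_ge0.
  by rewrite [X in (X <= _)%E]lebesgue_measure_centered.
have cov : (`[0, 1[%classic : set (measurableTypeR R)) `<=` \bigcup_k J k.
  move=> y; rewrite /= in_itv/= => yI.
  have [k _ Uk] : (\bigcup_k U k) (0, cantor_point r y).
    by apply: EU; exists (cantor_point r y) => //; exact: cantor_point_in.
  by exists k => //; apply: YJ.
have S1 : (1 <= \sum_(0 <= k <oo) (2 * rho k)%:E)%E.
  apply: (@le_trans _ _ (\sum_(0 <= k <oo) lebesgue_measure (J k))%E); last first.
    exact: lee_nneseries.
  apply: le_trans (measure_sigma_subadditive _ mJ _ cov); last exact: measurable_itv.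
  rewrite [X in (_ <= X)%E](@lebesgue_measure_itv R `[0, 1[)/= lte_fin ltr01.
  by rewrite -EFinB subr0.
have S2 : (\sum_(0 <= k <oo) (2 * rho k)%:E <=
    (2 / c `^ u)%:E * \sum_(0 <= k <oo) hausdorff_gauge v (U k))%E.
  rewrite -nneseriesZl => [|k _]; last exact: hausdorff_gauge_ge0.
  apply: lee_nneseries => [k _ _|k _]; first by rewrite lee_fin mulr_ge0.
  rewrite /rho /hausdorff_gauge; case: ifPn => _; first by rewrite mulr0 mule0.
  rewrite DE poweR_EFin -EFinM lee_fin powRM ?invr_ge0 ?(ltW c0)//.
  rewrite -powR_inv1 ?(ltW c0)// powRAC powR_inv1 ?powR_ge0//.
  rewrite -mulrA ler_pM2l// mulrC ler_pM2l ?invr_gt0//.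
  have [->|Dn] := eqVneq (D k) 0.
    by rewrite powR0 ?gt_eqF// powR_ge0.
  apply: ger_powR => //; by rewrite lt_neqAle eq_sym Dn D0 D1.
have := le_trans S1 S2; have q0 : 0 < 2 / c `^ u by rewrite divr_gt0.
have g0 : (0 <= \sum_(0 <= k <oo) hausdorff_gauge v (U k))%E.
  by apply: nneseries_ge0 => k _ _; exact: hausdorff_gauge_ge0.
case: (\sum_(0 <= k <oo) _)%E g0 => [q _| |//].
  by rewrite -EFinM !lee_fin ler_pdivrMr// mulrAC ler_pdivlMr// mul1r mulrC.
by move=> _ _; rewrite leey.
Qed.

Lemma vertical_cantor_dim (R : realType) (u r : R) :
  0 < u -> u < 1 -> r = 2^-1 `^ u^-1 ->
  (u%:E <= hausdorff_dim (vertical_cantor r))%E.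
Proof.
move=> u0 u1 rE; apply: le_ereal_inf_tmp => _ [v [v0 Hv] <-].
rewrite lee_fin leNgt; apply/negP => vu.
have := vertical_cantor_premeasure u0 u1 rE v0 (ltW vu).
have : (hausdorff_premeasure v 1 (vertical_cantor r) <= 0)%E.
  by rewrite -Hv; apply: ereal_sup_ubound; exists 1 => //=.
move=> h1 h2; have := le_trans h2 h1; rewrite lee_fin leNgt => /negP; apply.
have r12 : r < 2^-1 by rewrite rE; apply: powR_half_lt; rewrite invf_gt1.
by rewrite divr_gt0// powR_gt0//; lra.
Qed.

(** Fubini: vertical sections are empty or translates of the Cantor set. *)
Lemma vertical_cantor_sum_null (R : realType) (r a b : R) (f : R -> R) :
  0 < r -> r < 2^-1 ->
  planar_lebesgue (minkowski_sum (vertical_cantor r) (graph_on a b f)) = 0%E.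
Proof.
move=> r0 r12; rewrite /planar_lebesgue /product_measure1.
rewrite integral0_eq// => x _ /=.
have mC : measurable (cantor_set r : set (measurableTypeR R)).
  by apply: compact_measurable; exact: compact_cantor_set.
have [xI|xI] := pselect (x \in `[a, b]).
  rewrite (_ : xsection _ _ = [set v | cantor_set r (v - f x)]).
    by rewrite lebesgue_translate// cantor_set_null.
  apply/seteqP; split=> v; rewrite /xsection/= inE.
    by move=> [_ [t Ct <-] [_ [z zI <-] [<- <-]]]; rewrite add0r addrK.
  move=> Ct; exists (0, v - f x); first by exists (v - f x).
  exists (x, f x); first by exists x.
  by rewrite /GRing.add/= /add_pair/= add0r subrK.
rewrite (_ : xsection _ _ = set0) ?measure0//.
apply/seteqP; split=> v //; rewrite /xsection/= inE.
by move=> [_ [t Ct <-] [_ [z zI <-] [ez _]]]; apply: xI; rewrite -ez add0r.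
Qed.

Lemma compact_vertical_cantor (R : realType) (r : R) :
  compact (vertical_cantor r).
Proof.
apply: compact_vertical; exact: compact_cantor_set.
Qed.

(** * The threshold *)

Lemma exists_hausdorff_measure_neq0 (R : realType) (E : set (R * R)) :
  (1%:E < hausdorff_dim E)%E ->
  exists2 s, 1 < s & hausdorff_measure s E != 0%E.
Proof.
move=> Ed.
have [s s1 sd] : exists2 s, 1 < s & (s%:E < hausdorff_dim E)%E.
  case: (hausdorff_dim E) Ed => [q|_|//].
    rewrite lte_fin => q1; exists ((1 + q) / 2); last rewrite lte_fin; lra.
  by exists 2; rewrite ?ltry// ltr1n.
exists s => //; apply: contraTneq sd => Hs; rewrite -leNgt.
by apply: ereal_inf_lbound; exists s => //; split=> //; lra.
Qed.

Lemma curved_trace_sum_positive (R : realType) (G E : set (R * R)) :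
  compact G -> positive_curved_trace G -> compact E ->
  (1%:E < hausdorff_dim E)%E -> (0 < planar_lebesgue (minkowski_sum E G))%E.
Proof.
move=> cG [a [b [g [g1 [g2 [A [c0 [ab gC [cA AG] HA [c00 g2c]]]]]]]]] cE Ed.
have [s s1 Hs] := exists_hausdorff_measure_neq0 Ed.
pose P : set R := [set p.1 | p in A].
have Pab : P `<=` `[a, b].
  by move=> _ [p Ap <-]; have [_ [x xI <-]] := AG p Ap.
have AE : A = [set (p, g p) | p in P].
  apply/seteqP; split=> [p Ap|_ [_ [p Ap <-] <-]].
    by have [_ [x xI xp]] := AG p Ap; exists x => //; exists p => //; rewrite -xp.
  by have [_ [x xI xp]] := AG p Ap; rewrite -xp/= xp.
have cP : compact P.
  apply: continuous_compact => //; apply: continuous_subspaceT => z.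
  exact: cvg_fst.
have mP : measurable (P : set (measurableTypeR R)) by exact: compact_measurable.
have P0 : (0 < lebesgue_measure P)%E.
  rewrite lt_neqAle eq_sym measure_ge0 andbT; apply/eqP => P0.
  have [L L0 gL] := C2_lipschitz gC.
  move: HA; rewrite AE (lipschitz_graph_null mP P0 L0) ?ltxx// => x y Px Py.
  by apply: gL; exact: Pab.
rewrite AE in cA.
have pos := curve_sum_positive cE s1 Hs ab gC c00 g2c Pab cA mP P0.
apply: lt_le_trans pos _; apply: le_measure; rewrite ?inE.
- by apply: compact_plane_measurable; exact: compact_minkowski.
- by apply: compact_plane_measurable; exact: compact_minkowski.
- rewrite -AE => _ [x Ex [y Ay <-]]; exists x => //; exists y => //.
  by have [] := AG y Ay.
Qed.

Theorem corollary2p6 (R : realType) (Gamma : set (R * R)%type)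
    (Gamma_graph : nondegenerate_graph Gamma)
    (Gamma_rect : rectifiable_curve Gamma)
    (Gamma_trace : positive_curved_trace Gamma) :
  sum_threshold Gamma = 1%E.
Proof.
apply/eqP; rewrite eq_le; apply/andP; split.
  apply: ereal_inf_lbound; exists 1 => // E cE Ed.
  have [a [b [gamma [ab cg GE _]]]] := Gamma_rect.
  apply: curved_trace_sum_positive => //; rewrite GE.
  by apply: continuous_compact => //; exact: segment_compact.
apply: le_ereal_inf_tmp => _ [t Ht <-]; rewrite lee_fin leNgt; apply/negP => t1.
have [a [b [f [ab _ GE]]]] := Gamma_graph.
pose u := (Num.max t 0 + 1) / 2.
have tm : t <= Num.max t 0 by rewrite le_max lexx.
have m0 : 0 <= Num.max t 0 by rewrite le_max lexx orbT.
have m1 : Num.max t 0 < 1 by rewrite gt_max t1 ltr01.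
have [u0 u1 tu] : [/\ 0 < u, u < 1 & t < u] by rewrite /u; split; lra.
pose r := 2^-1 `^ u^-1 : R.
have r0 : 0 < r by rewrite powR_gt0// invr_gt0.
have r12 : r < 2^-1 by apply: powR_half_lt; rewrite invf_gt1.
have := Ht (vertical_cantor r) (@compact_vertical_cantor _ r).
rewrite GE vertical_cantor_sum_null// ltxx => H; suff : false by [].
apply: H; apply: lt_le_trans (vertical_cantor_dim u0 u1 erefl).
by rewrite lte_fin.
Qed.
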